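(* A graph $G$ is a Sterboul--Deming graph if and only if for every vertex $v$ of $G$ there is a maximum matching $M$ of $G$ such that $v$ belongs to an $M$-Jposy or an $M$-Jflower.
   Context: All graphs are finite, undirected and simple. Let $M$ be a matching of a graph $G$. A path (or walk) is $M$-alternating if, of any two consecutive edges, exactly one belongs to $M$; an $mm$-$M$-path (respectively $mm$-$M$-walk) is an $M$-alternating path (respectively walk) whose first and last edges are in $M$. An $M$-blossom is an odd cycle of length $2k+1$ with exactly $k$ edges in $M$; its base is the unique vertex of the cycle not covered by those $k$ edges. An $M$-Tflower consists of an $M$-blossom together with an $M$-stem, i.e. an $M$-alternating path of even length (possibly zero) connecting the base of the blossom to a vertex not saturated by $M$ in $G$, where the base is the only common vertex of the blossom and the stem. An $M$-Tposy consists of two $M$-blossoms joined by an $mm$-$M$-path whose endpoints are the bases of the two blossoms, such that no internal vertex of the path lies in the blossoms and the intersection of the two blossoms is either empty or an $mm$-$M$-path. An $M$-Jflower consists of an $M$-blossom together with an $M$-alternating walk of even length (possibly zero) connecting the base of the blossom to a vertex not saturated by $M$ in $G$ (no disjointness is required). An $M$-Jposy consists of two (not necessarily disjoint) $M$-blossoms joined by an $mm$-$M$-walk whose endpoints are the bases of the two blossoms. Define $SD(G)$ as the set of vertices $v$ of $G$ for which there is a maximum matching $M$ of $G$ such that $v$ lies in an $M$-Tflower or an $M$-Tposy, and $KE(G)=V(G)\setminus SD(G)$. A graph $G$ is a Sterboul--Deming graph if $KE(G)=\emptyset$. *)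

(* Defs.v *)
From HB Require Import structures.
From mathcomp Require Import all_boot.
From mathcomp Require Import boolp.

Set Implicit Arguments.
Unset Strict Implicit.
Unset Printing Implicit Defensive.

Record sgraph := SGraph {
  vertex :> finType;
  adj : rel vertex;
  adj_sym : symmetric adj;
  adj_irrefl : irreflexive adj }.

Definition edges (G : sgraph) : {set {set G}} :=
  [set [set x; y] | x in [set: G], y in adj x].

Definition matching (G : sgraph) (M : {set {set G}}) : bool :=
  (M \subset edges G) && trivIset M.

Definition max_matching (G : sgraph) (M : {set {set G}}) : bool :=
  matching M && [forall N : {set {set G}}, matching N ==> (#|N| <= #|M|)].

Definition saturated (G : sgraph) (M : {set {set G}}) (v : G) : bool :=
  v \in cover M.

(* The walk with vertex sequence x :: p has length size p and ends at         *)
(* last x p; it is a path when x :: p is duplicate-free.                      *)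
Definition walk_edges (G : sgraph) (x : G) (p : seq G) : seq {set G} :=
  pairmap (fun y z => [set y; z]) x p.

Definition alt_walk (G : sgraph) (M : {set {set G}}) (x : G) (p : seq G) :
    bool :=
  path (@adj G) x p &&
  sorted (fun f g => (f \in M) (+) (g \in M)) (walk_edges x p).

Definition alt_path (G : sgraph) (M : {set {set G}}) (x : G) (p : seq G) :
    bool :=
  alt_walk M x p && uniq (x :: p).

Definition mm_ends (G : sgraph) (M : {set {set G}}) (s : seq {set G}) : bool :=
  if s is f :: s' then (f \in M) && (last f s' \in M) else false.

Definition mm_walk (G : sgraph) (M : {set {set G}}) (x : G) (p : seq G) :
    bool :=
  alt_walk M x p && mm_ends M (walk_edges x p).

Definition mm_path (G : sgraph) (M : {set {set G}}) (x : G) (p : seq G) :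
    bool :=
  mm_walk M x p && uniq (x :: p).

(* A cycle is given by its vertices in cyclic order.                          *)
Definition cycle_edges (G : sgraph) (c : seq G) : {set {set G}} :=
  [set [set x; next c x] | x in c].

Definition blossom (G : sgraph) (M : {set {set G}}) (c : seq G) : bool :=
  [&& cycle (@adj G) c, uniq c, 2 < size c, odd (size c)
    & #|cycle_edges c :&: M| == (size c)./2].

Definition blossom_base (G : sgraph) (M : {set {set G}}) (c : seq G) (b : G) :
    bool :=
  (b \in c) && (b \notin cover (cycle_edges c :&: M)).

Definition Tflower (G : sgraph) (M : {set {set G}})
    (c : seq G) (b : G) (p : seq G) : Prop :=
  [/\ blossom M c /\ blossom_base M c b,
      alt_path M b p,
      ~~ odd (size p),
      ~~ saturated M (last b p)
    & [set x in c] :&: [set x in b :: p] = [set b]].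

(* The intersection is taken as subgraphs: common vertices and common edges.  *)
Definition cycles_meet_in_mm_path (G : sgraph) (M : {set {set G}})
    (c1 c2 : seq G) : Prop :=
  exists (x : G) (p : seq G),
    [/\ mm_path M x p,
        [set y in c1] :&: [set y in c2] = [set y in x :: p]
      & cycle_edges c1 :&: cycle_edges c2 = [set f in walk_edges x p]].

(* The joining path has endpoints b1, b2 and internal vertices q.             *)
Definition Tposy (G : sgraph) (M : {set {set G}})
    (c1 c2 : seq G) (b1 : G) (q : seq G) (b2 : G) : Prop :=
  [/\ blossom M c1 /\ blossom_base M c1 b1,
      blossom M c2 /\ blossom_base M c2 b2,
      mm_path M b1 (rcons q b2),
      forall x, x \in q -> x \notin c1 /\ x \notin c2
    & [set x in c1] :&: [set x in c2] = set0 \/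
      cycles_meet_in_mm_path M c1 c2].

Definition Jflower (G : sgraph) (M : {set {set G}})
    (c : seq G) (b : G) (p : seq G) : Prop :=
  [/\ blossom M c /\ blossom_base M c b,
      alt_walk M b p,
      ~~ odd (size p)
    & ~~ saturated M (last b p)].

Definition Jposy (G : sgraph) (M : {set {set G}})
    (c1 c2 : seq G) (b1 : G) (q : seq G) (b2 : G) : Prop :=
  [/\ blossom M c1 /\ blossom_base M c1 b1,
      blossom M c2 /\ blossom_base M c2 b2
    & mm_walk M b1 (rcons q b2)].

Definition in_Tflower (G : sgraph) (M : {set {set G}}) (v : G) : Prop :=
  exists (c : seq G) (b : G) (p : seq G),
    Tflower M c b p /\ (v \in c \/ v \in b :: p).

Definition in_Tposy (G : sgraph) (M : {set {set G}}) (v : G) : Prop :=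
  exists (c1 c2 : seq G) (b1 : G) (q : seq G) (b2 : G),
    Tposy M c1 c2 b1 q b2 /\ [\/ v \in c1, v \in c2 | v \in b1 :: rcons q b2].

Definition in_Jflower (G : sgraph) (M : {set {set G}}) (v : G) : Prop :=
  exists (c : seq G) (b : G) (p : seq G),
    Jflower M c b p /\ (v \in c \/ v \in b :: p).

Definition in_Jposy (G : sgraph) (M : {set {set G}}) (v : G) : Prop :=
  exists (c1 c2 : seq G) (b1 : G) (q : seq G) (b2 : G),
    Jposy M c1 c2 b1 q b2 /\ [\/ v \in c1, v \in c2 | v \in b1 :: rcons q b2].

Definition SD (G : sgraph) : {set G} :=
  [set v | `[< exists M : {set {set G}},
                 max_matching M /\ (in_Tflower M v \/ in_Tposy M v) >]].

Definition KE (G : sgraph) : {set G} := [set: G] :\: SD G.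

Definition sterboul_deming (G : sgraph) : Prop := KE G = set0.

(* Main.v *)
(* Pendant vertices with a loop, one at each vertex missed by the maximum       *)
(* matching M, turn M into a perfect matching, flowers into posies, and stems   *)
(* into joining paths. In a graph T with a perfect matching call a vertex v     *)
(* central if f v = 1 for every f : T -> nat with f x + f y >= 2 on all edges   *)
(* and total weight at most #|T|; such an f sums to 2 on every edge of every    *)
(* perfect matching, so centrality does not depend on the matching, and it      *)
(* propagates along a Jflower or Jposy to all of its vertices.                  *)
(* Conversely a central v has alternating closed walks on both sides of its     *)
(* matching edge. A posy is, independently of any matching, a barbell (two odd  *)
(* cycles joined by an odd path) or a K4 with edges subdivided into odd paths,  *)
(* such that the rest of the graph has a perfect matching. One such frame       *)
(* exists in the connected component of v among the central vertices: an odd    *)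
(* cycle closed by the walks yields a barbell, or a theta graph with two even   *)
(* paths and one odd path; as long as the walks do not complete the theta graph *)
(* to a frame, they give a theta graph with a shorter odd path. Finally, a      *)
(* central neighbour of a frame lies on an ear or on a lollipop attached to the *)
(* frame, and case analysis on parities finds a frame through it.               *)

Require Import Defs.
From mathcomp Require Import all_boot.
From mathcomp Require Import boolp zify.

Set Implicit Arguments.
Unset Strict Implicit.
Unset Printing Implicit Defensive.

(** A T-structure is in particular a J-structure, so the content lies in the other direction.
    Alternating walks may repeat vertices and blossoms may overlap, so a simple structure through a
    given vertex cannot be read off directly; half-integral vertex covers mediate. Weights along a
    walk do not notice repetitions: by [blossom_base_ge1] the base of a blossom has weight at least
    1, and [alt_walk_ones] carries this along the walk. Hence [Jflower_central] and [Jposy_central]: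
    every vertex of a J-structure is [central] in the graph with pendant loops.

    Conversely, [escape] is the duality step. If no alternating walk from a set of central vertices
    came back in a useful way, giving weight 0 to the vertices reached, 2 to their partners and 1
    elsewhere would be a cover that contradicts centrality. So there is an ear or a lollipop.
    [framedK_exists] uses this to build a first frame (a barbell or a subdivided K4) among the
    central vertices connected to [v], and [framed_adj] passes from a frame to a frame through any
    given central neighbour, by the case analyses [barbell_ear], [k4_ear] and [frame_lam]. Together
    they give [central_framed].

    No matching is kept fixed on the way. A frame is only required to be [nice], that is, to leave a
    perfectly matchable rest, and paths with an even number of vertices can be rematched or
    discarded at will ([nice_rm]). This freedom is legitimate because membership in [SD] allows a
    different maximum matching for each vertex. At the end [framed_T_central] reads a frame of the
    pendant graph as a posy or a flower of [G]; a barbell based at two pendant vertices would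
    contain an augmenting path ([no_free_free]). *)

Ltac perm_count := apply/permP=> ?; rewrite -?cats1;
  repeat progress rewrite ?(count_cat, count_rev, cats0) /=; clear; lia.
(** Permutations of concatenations are checked by counting an arbitrary predicate on both sides:
    reversals disappear and linear arithmetic remains. The argument [p] is a permutation already
    known. *)
Ltac perm_count_with p := let z := fresh in apply/permP=> z;
  move: p => /permP/(_ z); rewrite -?cats1;
  repeat progress rewrite ?(count_cat, count_rev, cats0) /=; clear; lia.
Ltac perm_count_with2 p q := let z := fresh in apply/permP=> z;
  move: p q => /permP/(_ z) + /permP/(_ z); rewrite -?cats1;
  repeat progress rewrite ?(count_cat, count_rev, cats0) /=; clear; lia.
Ltac sub_mem := let x := fresh in let xr := fresh in move=> x xr;
  rewrite !(inE, mem_cat, mem_rev, mem_rcons) xr ?orbT.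

(** * Perfect matchings and alternating links *)

Section PerfectMatchings.

Variables (T : finType) (e : rel T).
Hypothesis esym : symmetric e.

Definition link a p b := path e a (rcons p b).

Lemma link_cat a p h q b : link a (p ++ h :: q) b = link a p h && link h q b.
Proof. by rewrite /link rcons_cat -cat_rcons cat_path last_rcons. Qed.

Lemma link_rev a p b : link b (rev p) a = link a p b.
Proof.
have := rev_path e a (rcons p b); rewrite last_rcons belast_rcons rev_cons /link => ->.
by apply: eq_path => x y; rewrite /= esym.
Qed.

(** Only interior vertices are listed, so [k] is the parity of their number: [klink false] is a walk
    of odd length and [klink true] one of even length, whence the notations [ol] and [el]. With [p]
    empty and [a = b] it is a loop, an odd closed walk. *)
Definition klink k a p b := link a p b && (odd (size p) == k).

Lemma klink_cat k1 k2 a p h q b :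
  klink k1 a p h -> klink k2 h q b -> klink (~~ (k1 (+) k2)) a (p ++ h :: q) b.
Proof.
move=> /andP[l1 /eqP <-] /andP[l2 /eqP <-].
by rewrite /klink link_cat l1 l2 size_cat /= oddD /= addbN.
Qed.

Lemma klink_split k a p h q b : klink k a (p ++ h :: q) b ->
  (klink false a p h /\ klink (~~ k) h q b) \/
  (klink true a p h /\ klink k h q b).
Proof.
rewrite /klink link_cat size_cat /= oddD /= addbN => /andP[/andP[-> ->]] /=.
by case: (odd (size p)); case: (odd (size q)); case: k => //= _; by [left|right].
Qed.

Lemma klink_rev k a p b : klink k a p b -> klink k b (rev p) a.
Proof. by rewrite /klink link_rev size_rev. Qed.

Lemma klink_nil a b : e a b -> klink false a [::] b.
Proof. by rewrite /klink /link /= => ->. Qed.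

(** Even chains: pairing consecutive vertices matches such a chain within itself, so it can be
    rematched or thrown away. *)
Definition evc l := sorted e l && ~~ odd (size l).

Lemma evc_in a p b : klink false a p b -> evc p.
Proof.
by rewrite /evc /klink /link rcons_path => /andP[/andP[/path_sorted -> _] /eqP ->].
Qed.

Lemma evc_r a p b : klink true a p b -> evc (rcons p b).
Proof. by rewrite /evc /klink /link size_rcons /= => /andP[/path_sorted -> /eqP ->]. Qed.

Lemma evc_l a p b : klink true a p b -> evc (a :: p).
Proof. by rewrite /evc /klink /link rcons_path /= => /andP[/andP[-> _] /eqP ->]. Qed.

Lemma evc_lr a p b : klink false a p b -> evc (a :: rcons p b).
Proof. by rewrite /evc /klink /link /= size_rcons /= => /andP[-> /eqP ->]. Qed.

(** A perfect matching of [A] as a partner map; [s x != x] is explicit because [e] may have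
    loops. *)
Definition pmf (A : {set T}) (s : T -> T) :=
  forall x, x \in A -> [/\ s x \in A, s (s x) = x, s x != x & e x (s x)].

Definition pm A := exists s, pmf A s.

Fixpoint paired (s : T -> T) (l : seq T) : Prop :=
  match l with
  | x :: y :: l' => [/\ s x = y, s y = x & paired s l']
  | x :: nil => False
  | nil => True
  end.

Lemma seq_pair_ind (P : seq T -> Prop) :
  P [::] -> (forall x, P [:: x]) -> (forall x y l, P l -> P [:: x, y & l]) ->
  forall l, P l.
Proof.
move=> P0 P1 P2 l; suff: P l /\ forall x, P (x :: l) by case.
by elim: l => [|y l [IH1 IH2]]; split=> // x; apply: P2.
Qed.

Lemma eq_paired s s' l : {in l, s =1 s'} -> paired s l -> paired s' l.
Proof.
elim/seq_pair_ind: l => //= x y l IH E [sx sy pl]; split.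
- by rewrite -E ?inE ?eqxx.
- by rewrite -E ?inE ?eqxx ?orbT.
- by apply: IH => // z zl; apply: E; rewrite !inE zl !orbT.
Qed.

(** The chain is peeled off two vertices at a time, each pair being swapped by the new map. The
    conclusion [paired s' l] later determines which edges of a blossom, stem or joining path are
    matching edges. *)
Lemma pm_glue l (A : {set T}) s : evc l -> uniq l -> [disjoint l & A] -> pmf A s ->
  exists s', [/\ pmf (A :|: [set x in l]) s', paired s' l & {in A, s' =1 s}].
Proof.
elim/seq_pair_ind: l => [|x|x y l IH]; rewrite /evc.
- move=> _ _ _ sA; exists s; split=> //.
  have -> : A :|: [set x in [::]] = A by apply/setP=> z; rewrite !inE orbF.
  exact: sA.
- by rewrite andbF.
rewrite /= negbK => /andP[/andP[exy /path_sorted sl] ol].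
rewrite !inE negb_or => /and3P[/andP[xy xl] yl ul].
rewrite !disjoint_cons => /and3P[xA yA dl] sA.
have [|s' [s'P s'l s'A]] := IH _ ul dl sA; first by rewrite /evc sl ol.
pose s2 z := if z == x then y else if z == y then x else s' z.
have s2x : s2 x = y by rewrite /s2 eqxx.
have s2y : s2 y = x by rewrite /s2 eqxx eq_sym (negPf xy).
have s2E z : z != x -> z != y -> s2 z = s' z.
  by rewrite /s2 => /negPf -> /negPf ->.
have xnA z : z \in A :|: [set z in l] -> (z != x) && (z != y).
  move=> zA; apply/andP; split; apply/eqP=> E; move: zA; rewrite E !inE.
    by rewrite (negPf xA) (negPf xl).
  by rewrite (negPf yA) (negPf yl).
exists s2; split.
- move=> z. rewrite !inE => zP.
  have [->|zx] := eqVneq z x.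
    rewrite s2x s2y; split=> //; [by rewrite eqxx !orbT | by rewrite eq_sym].
  have [->|zy] := eqVneq z y.
    rewrite s2y s2x; split=> //; [by rewrite eqxx !orbT | by rewrite esym].
  have zA : z \in A :|: [set z in l].
    by move: zP; rewrite (negPf zx) (negPf zy) !inE.
  have [h1 h2 h3 h4] := s'P _ zA.
  have /andP[h5 h6] := xnA _ h1.
  rewrite s2E // s2E // h2; split=> //.
  by move: h1; rewrite !inE; case/orP=> ->; rewrite ?orbT.
- split=> //; apply: eq_paired s'l => z zl.
  have /andP[h5 h6] : (z != x) && (z != y) by apply: xnA; rewrite !inE zl orbT.
  by rewrite s2E.
- move=> z zA.
  have /andP[h5 h6] : (z != x) && (z != y) by apply: xnA; rewrite !inE zA.
  by rewrite s2E // s'A.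
Qed.

Lemma pm_glues ls (A : {set T}) s : all evc ls -> uniq (flatten ls) ->
    [disjoint flatten ls & A] -> pmf A s ->
  exists s', [/\ pmf (A :|: [set x in flatten ls]) s',
    forall l, l \in ls -> paired s' l & {in A, s' =1 s}].
Proof.
elim: ls A s => [|l ls IH] A s /=.
  move=> _ _ _ sA; exists s; split=> //.
  have -> : A :|: [set x in [::]] = A by apply/setP=> z; rewrite !inE orbF.
  exact: sA.
move=> /andP[el els]; rewrite cat_uniq => /and3P[ul /hasPn nl uls].
rewrite disjoint_cat => /andP[dl dls] sA.
have [s1 [s1P s1l s1A]] := pm_glue el ul dl sA.
have [|s2 [s2P s2l s2A]] := IH _ _ els uls _ s1P.
  rewrite disjoint_subset; apply/subsetP => z zl; rewrite !inE negb_or nl // andbT.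
  by move: dls; rewrite disjoint_subset => /subsetP/(_ z zl); rewrite inE.
exists s2; split.
- suff -> : A :|: [set x in l ++ flatten ls] =
            A :|: [set x in l] :|: [set x in flatten ls] by [].
  by apply/setP=> z; rewrite !inE mem_cat orbA.
- move=> l'; rewrite inE => /predU1P[->|/s2l //].
  by apply: eq_paired s1l => z zl; rewrite s2A // !inE zl orbT.
- by move=> z zA; rewrite s2A ?s1A // inE zA.
Qed.

(** The vertex set of a conformal subgraph: what remains after its removal has a perfect
    matching. *)
Definition nice (vs : seq T) := pm (~: [set x in vs]).

Lemma nice_total ls : all evc ls -> uniq (flatten ls) -> nice (flatten ls) ->
  exists s, pmf [set: T] s /\ forall l, l \in ls -> paired s l.
Proof.
move=> ev u [s sP].
have [|s' [s'P s'l _]] := pm_glues ev u _ sP.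
  by rewrite disjoint_subset; apply/subsetP=> z; rewrite !inE negbK.
by exists s'; split=> // z _; have := s'P z; rewrite !inE /= orNb => /(_ isT) [].
Qed.

Lemma nice_rm W vs ls : all evc ls -> uniq W -> nice W ->
  perm_eq W (vs ++ flatten ls) -> nice vs.
Proof.
move=> ev u [s sP] pe.
have E z : (z \in W) = (z \in vs) || (z \in flatten ls).
  by rewrite (perm_mem pe) mem_cat.
have := u; rewrite (perm_uniq pe) cat_uniq => /and3P[uv /hasPn nl ul].
have [|s' [s'P _ _]] := pm_glues ev ul _ sP.
  by rewrite disjoint_subset; apply/subsetP=> z zl; rewrite !inE negbK E zl orbT.
rewrite /nice; suff -> : ~: [set x in vs] = ~: [set x in W] :|: [set x in flatten ls] by exists s'.
apply/setP=> z; rewrite !inE E; have := nl z.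
by case: (z \in flatten ls); case: (z \in vs) => //= /(_ isT).
Qed.

Lemma nice_perm vs vs' : perm_eq vs vs' -> nice vs -> nice vs'.
Proof.
move=> pe; rewrite /nice; suff -> : [set x in vs] = [set x in vs'] by [].
by apply/setP=> z; rewrite !inE (perm_mem pe).
Qed.

Lemma nice_closed s vs : pmf [set: T] s -> (forall x, x \in vs -> s x \in vs) ->
  nice vs.
Proof.
move=> sP cl; exists s => x; rewrite !inE => xv.
have [_ h2 h3 h4] := sP x (in_setT _); split=> //.
by apply: contra xv => /cl; rewrite h2.
Qed.

Lemma paired_closed s l : paired s l -> forall x, x \in l -> s x \in l.
Proof.
elim/seq_pair_ind: l => //= x y l IH [sx sy pl] z.
rewrite !inE => /or3P[/eqP->|/eqP->|/(IH pl)->]; rewrite ?sx ?sy ?eqxx ?orbT //.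
Qed.

End PerfectMatchings.

(** * Barbells and subdivisions of K4 *)

Section Structures.

Variables (T : finType) (e : rel T).
Hypothesis esym : symmetric e.

Notation ol := (klink e false).
Notation el := (klink e true).
Notation evc := (evc e).
Notation nice := (nice e).

Definition barbell b1 o1 q b2 o2 := [/\ ol b1 o1 b1, ol b1 q b2 & ol b2 o2 b2].

Definition barbell_seq b1 o1 q b2 (o2 : seq T) := b1 :: o1 ++ q ++ b2 :: o2.

Definition k4 a b c d ab ac ad bc bd cd :=
  [/\ ol a ab b, ol a ac c & ol a ad d] /\ [/\ ol b bc c, ol b bd d & ol c cd d].

Definition k4_seq a b c d ab ac ad bc bd (cd : seq T) :=
  [:: a; b; c; d] ++ ab ++ ac ++ ad ++ bc ++ bd ++ cd.

(** Posies with the matching forgotten: two disjoint blossoms give a barbell, two blossoms meeting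
    in a path give a subdivided K4. An empty [o1] or [o2] is a loop; flowers enter as barbells with
    such a loop. *)
Inductive sd_frame : seq T -> Prop :=
| FrameBarbell b1 o1 q b2 o2 of barbell b1 o1 q b2 o2 :
    sd_frame (barbell_seq b1 o1 q b2 o2)
| FrameK4 a b c d ab ac ad bc bd cd of k4 a b c d ab ac ad bc bd cd :
    sd_frame (k4_seq a b c d ab ac ad bc bd cd).

Definition niceu vs := uniq vs /\ nice vs.

Definition framed (r : seq T) :=
  exists vs, [/\ sd_frame vs, niceu vs & {subset r <= vs}].

Lemma niceu_perm vs vs' : perm_eq vs vs' -> niceu vs -> niceu vs'.
Proof. by move=> p [u n]; split; [rewrite -(perm_uniq p) | apply: nice_perm p n]. Qed.

(** The pattern of every ear case: a new frame [vs] is cut out of the old frame with its ear, and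
    the discarded pieces [ls] are even chains. *)
Lemma framedI W vs ls r : sd_frame vs -> niceu W -> all evc ls ->
  perm_eq W (vs ++ flatten ls) -> {subset r <= vs} -> framed r.
Proof.
move=> f [u n] ev pe sub; exists vs; split=> //; split.
  by move: u; rewrite (perm_uniq pe) cat_uniq => /andP[].
exact: nice_rm ev u n pe.
Qed.

Lemma olr a p b : ol a p b -> ol b (rev p) a. Proof. exact: klink_rev. Qed.
Lemma elr a p b : el a p b -> el b (rev p) a. Proof. exact: klink_rev. Qed.
Lemma oo a p h q b : ol a p h -> ol h q b -> el a (p ++ h :: q) b.
Proof. exact: klink_cat. Qed.
Lemma oe a p h q b : ol a p h -> el h q b -> ol a (p ++ h :: q) b.
Proof. exact: klink_cat. Qed.
Lemma eo a p h q b : el a p h -> ol h q b -> ol a (p ++ h :: q) b.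
Proof. exact: klink_cat. Qed.
Lemma ee a p h q b : el a p h -> el h q b -> el a (p ++ h :: q) b.
Proof. exact: klink_cat. Qed.
Lemma ol_split a p h q b : ol a (p ++ h :: q) b ->
  (ol a p h /\ el h q b) \/ (el a p h /\ ol h q b).
Proof. exact: klink_split. Qed.
Lemma el_split a p h q b : el a (p ++ h :: q) b ->
  (ol a p h /\ ol h q b) \/ (el a p h /\ el h q b).
Proof. exact: klink_split. Qed.

Lemma mem_split (x : T) l : x \in l -> exists p q, l = p ++ x :: q.
Proof. by case/splitPr=> p q; exists p, q. Qed.

Lemma mem_split2 (x y : T) l : x \in l -> y \in l -> x != y ->
  exists p m q, l = p ++ x :: m ++ y :: q \/ l = p ++ y :: m ++ x :: q.
Proof.
case/mem_split=> p [q ->]; rewrite mem_cat inE => yl xy.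
case/or3P: yl => [/mem_split[p1 [p2 ->]]||/mem_split[q1 [q2 ->]]].
- by exists p1, p2, q; right; rewrite -catA.
- by rewrite eq_sym (negPf xy).
- by exists p, q1, q2; left.
Qed.

Lemma cycle_rot b o h : ol b o b -> h \in b :: o ->
  exists2 o', ol h o' h & perm_eq (b :: o) (h :: o').
Proof.
move=> l; rewrite inE => /predU1P[->|]; first by exists o.
case/mem_split=> p [s def]; move: l; rewrite {}def => /ol_split[] [l1 l2].
  by exists (s ++ b :: p); [exact: eo | perm_count].
by exists (s ++ b :: p); [exact: oe | perm_count].
Qed.

(** * Odd ears attached to a barbell *)

Lemma barbell_sym b1 o1 q b2 o2 : barbell b1 o1 q b2 o2 ->
  barbell b2 o2 (rev q) b1 o1.
Proof. by case=> l1 l2 l3; split=> //; apply: olr. Qed.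

Lemma barbell_rev b1 o1 q b2 o2 : barbell b1 o1 q b2 o2 ->
  barbell b1 (rev o1) q b2 o2.
Proof. by case=> l1 l2 l3; split=> //; apply: olr. Qed.

Lemma framed_rev r : framed (rev r) -> framed r.
Proof.
by case=> vs [f n sub]; exists vs; split=> // x xr; apply: sub; rewrite mem_rev.
Qed.

Lemma barbell_ear_cross b1 o1 q b2 o2 r h1 h2 :
  barbell b1 o1 q b2 o2 -> niceu (barbell_seq b1 o1 q b2 o2 ++ r) ->
  ol h1 r h2 -> h1 \in b1 :: o1 -> h2 \in b2 :: o2 -> framed r.
Proof.
case=> l1 l2 l3 n lr /(cycle_rot l1)[o1' l1' p1] /(cycle_rot l3)[o2' l3' p3].
apply: (framedI (FrameBarbell (And3 l1' lr l3')) n (ls := [:: q])).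
- by rewrite /= (evc_in l2).
- by perm_count_with2 p1 p3.
- by sub_mem.
Qed.

(** If [h2] is at odd distance from [b1] along [q], the ear replaces that part of the joining path.
    Otherwise the ear and the part of [q] before [h2], together with an arc of the cycle when [h1]
    is not [b1], close up to an odd cycle based at [h2]. *)
Lemma barbell_ear_stem b1 o1 q b2 o2 r h1 h2 :
  barbell b1 o1 q b2 o2 -> niceu (barbell_seq b1 o1 q b2 o2 ++ r) ->
  ol h1 r h2 -> h1 \in b1 :: o1 -> h2 \in q -> framed r.
Proof.
move=> bb n lr h1o /mem_split[q1 [q2 qE]].
have [l1 l2 l3] := bb; move: l2; rewrite qE => /ol_split[] [la lb].
  have [o1' l1' p1] := cycle_rot l1 h1o.
  apply: (framedI (FrameBarbell (And3 l1' (oe lr lb) l3)) n (ls := [:: q1])).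
  - by rewrite /= (evc_in la).
  - by rewrite qE; perm_count_with p1.
  - by sub_mem.
move: h1o; rewrite inE => /predU1P[E|/mem_split[p [s oE]]].
  rewrite {}E in lr.
  apply: (framedI (FrameBarbell (And3 (oe (olr lr) la) lb l3)) n (ls := [:: o1])).
  - by rewrite /= (evc_in l1).
  - by rewrite qE; perm_count.
  - by sub_mem.
(* The two arcs of an odd cycle between [b1] and [h1] have different parities; the even arc [p'] is
   kept and the odd arc [s'] is dropped. *)
have [p' [s' [pl sl pe]]] :
    exists p' s', [/\ el b1 p' h1, ol h1 s' b1 & perm_eq o1 (p' ++ h1 :: s')].
  move: l1; rewrite oE => /ol_split[] [lc ld]; last by exists p, s.
  by exists (rev s), (rev p); split; [exact: elr|exact: olr|perm_count].
have lc := oe (olr lr) (ee (elr pl) la).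
apply: (framedI (FrameBarbell (And3 lc lb l3)) n (ls := [:: s'])).
- by rewrite /= (evc_in sl).
- by rewrite qE; perm_count_with pe.
- by sub_mem.
Qed.

Lemma barbell_ear_base b1 o1 q b2 o2 r h2 :
  barbell b1 o1 q b2 o2 -> niceu (barbell_seq b1 o1 q b2 o2 ++ r) ->
  ol b1 r h2 -> h2 \in o1 -> framed r.
Proof.
move=> [l1 l2 l3] n lr /mem_split[m [s oE]].
have [p' [s' [pl sl pe]]] :
    exists p' s', [/\ el b1 p' h2, ol h2 s' b1 & perm_eq o1 (p' ++ h2 :: s')].
  move: l1; rewrite oE => /ol_split[] [lc ld]; last by exists m, s.
  by exists (rev s), (rev m); split; [exact: elr|exact: olr|perm_count].
apply: (framedI (FrameBarbell (And3 (oe lr (elr pl)) l2 l3)) n (ls := [:: s'])).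
- by rewrite /= (evc_in sl).
- by perm_count_with pe.
- by sub_mem.
Qed.

(** An odd arc [m] is replaced by the ear. An even arc [m] forms an odd cycle with the ear; exactly
    one of the arcs [p] and [s] is then even, and it prolongs the joining path. *)
Lemma barbell_ear_cycle b1 p h1 m h2 s q b2 o2 r :
  barbell b1 (p ++ h1 :: m ++ h2 :: s) q b2 o2 ->
  niceu (barbell_seq b1 (p ++ h1 :: m ++ h2 :: s) q b2 o2 ++ r) ->
  ol h1 r h2 -> framed r.
Proof.
move=> [l1 l2 l3] n lr.
have odd_case p' g1 m' g2 s' r' : el b1 p' g1 -> el g1 m' g2 -> ol g2 s' b1 ->
    ol g1 r' g2 ->
    perm_eq (p ++ h1 :: m ++ h2 :: s ++ r) (p' ++ g1 :: m' ++ g2 :: s' ++ r') ->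
    framed r'.
  move=> lp lm ls lr' pe.
  have bb := And3 (oe lr' (elr lm)) (eo (elr lp) l2) l3.
  apply: (framedI (FrameBarbell bb) n (ls := [:: s'])).
  - by rewrite /= (evc_in ls).
  - by perm_count_with pe.
  - by sub_mem.
case/ol_split: l1 => -[lp].
  case/el_split=> -[lm ls].
    apply: (framedI (FrameBarbell (And3 (oe lp (oo lr ls)) l2 l3)) n (ls := [:: m])).
    - by rewrite /= (evc_in lm).
    - by perm_count.
    - by sub_mem.
  apply: framed_rev; apply: (odd_case (rev s) h2 (rev m) h1 (rev p) _ (elr ls) (elr lm) (olr lp) (olr lr)).
  by perm_count.
case/ol_split=> -[lm ls].
  apply: (framedI (FrameBarbell (And3 (eo lp (oe lr ls)) l2 l3)) n (ls := [:: m])).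
  - by rewrite /= (evc_in lm).
  - by perm_count.
  - by sub_mem.
exact: (odd_case p h1 m h2 s r).
Qed.

(** Again an odd segment [m] is replaced by the ear. An even one forms an odd cycle with it, and
    whichever of [q1], [q2] is odd joins this cycle to an old one; the other side of the barbell is
    dropped. *)
Lemma barbell_ear_path b1 o1 q1 h1 m h2 q2 b2 o2 r :
  barbell b1 o1 (q1 ++ h1 :: m ++ h2 :: q2) b2 o2 ->
  niceu (barbell_seq b1 o1 (q1 ++ h1 :: m ++ h2 :: q2) b2 o2 ++ r) ->
  ol h1 r h2 -> framed r.
Proof.
move=> [l1 l2 l3] n lr.
case/ol_split: l2 => -[lp].
  case/el_split=> -[lm ls].
    apply: (framedI (FrameBarbell (And3 l1 (oe lp (oo lr ls)) l3)) n (ls := [:: m])).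
    - by rewrite /= (evc_in lm).
    - by perm_count.
    - by sub_mem.
  apply: (framedI (FrameBarbell (And3 l1 lp (oe lr (elr lm)))) n (ls := [:: rcons q2 b2; o2])).
  - by rewrite /= (evc_in l3) (evc_r ls).
  - by perm_count.
  - by sub_mem.
case/ol_split=> -[lm ls].
  apply: (framedI (FrameBarbell (And3 l1 (eo lp (oe lr ls)) l3)) n (ls := [:: m])).
  - by rewrite /= (evc_in lm).
  - by perm_count.
  - by sub_mem.
apply: (framedI (FrameBarbell (And3 (oe (olr lr) lm) ls l3)) n (ls := [:: b1 :: q1; o1])).
- by rewrite /= (evc_in l1) (evc_l lp).
- by perm_count.
- by sub_mem.
Qed.

Lemma barbell_ear b1 o1 q b2 o2 r h1 h2 :
  barbell b1 o1 q b2 o2 -> niceu (barbell_seq b1 o1 q b2 o2 ++ r) ->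
  ol h1 r h2 -> h1 != h2 -> h1 \in barbell_seq b1 o1 q b2 o2 ->
  h2 \in barbell_seq b1 o1 q b2 o2 -> framed r.
Proof.
move=> bb n lr h12.
have n' : niceu (barbell_seq b1 o1 q b2 o2 ++ rev r).
  by apply: niceu_perm n; rewrite perm_cat2l perm_sym perm_rev.
have bb' := barbell_sym bb.
have ps r' : perm_eq (barbell_seq b1 o1 q b2 o2 ++ r') (barbell_seq b2 o2 (rev q) b1 o1 ++ r').
  by perm_count.
have ns := niceu_perm (ps r) n; have ns' := niceu_perm (ps _) n'.
have same b o p c u g1 g2 r' : barbell b o p c u ->
    niceu (barbell_seq b o p c u ++ r') -> niceu (barbell_seq b o p c u ++ rev r') ->
    ol g1 r' g2 -> g1 != g2 -> g1 \in b :: o -> g2 \in b :: o -> framed r'.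
  move=> B N N' L g12; rewrite !inE => /predU1P[E1|i1] /predU1P[E2|i2].
  - by move: g12; rewrite E1 E2 eqxx.
  - by rewrite E1 in L; apply: barbell_ear_base B N L i2.
  - by rewrite E2 in L; apply/framed_rev; apply: barbell_ear_base B N' (olr L) i1.
  - have [p1 [m [s [E|E]]]] := mem_split2 i1 i2 g12; rewrite {}E in B N N'.
      exact: barbell_ear_cycle B N L.
    by apply/framed_rev; exact: barbell_ear_cycle B N' (olr L).
have mE x : (x \in barbell_seq b1 o1 q b2 o2) =
    [|| x \in b1 :: o1, x \in q | x \in b2 :: o2].
  by rewrite /barbell_seq !(inE, mem_cat) -!orbA.
have mR x : x \in q -> x \in rev q by rewrite mem_rev.
rewrite !{}mE => /or3P[] i1 /or3P[] i2.
- exact: same bb n n' lr h12 i1 i2.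
- exact: barbell_ear_stem bb n lr i1 i2.
- exact: barbell_ear_cross bb n lr i1 i2.
- by apply/framed_rev; apply: barbell_ear_stem bb n' (olr lr) i2 i1.
- have [p1 [m [s [E|E]]]] := mem_split2 i1 i2 h12; rewrite {}E in bb n n'.
    exact: barbell_ear_path bb n lr.
  by apply/framed_rev; exact: barbell_ear_path bb n' (olr lr).
- by apply/framed_rev; apply: barbell_ear_stem bb' ns' (olr lr) i2 (mR _ i1).
- by apply/framed_rev; apply: barbell_ear_cross bb n' (olr lr) i2 i1.
- exact: barbell_ear_stem bb' ns lr i1 (mR _ i2).
- exact: same bb' ns ns' lr h12 i1 i2.
Qed.

(** From [h] an odd path leads to the base of an odd cycle, and the rest of [vs] falls into even
    chains. This is half a barbell: an odd cycle at [h], or one reached from [h] by an even stem,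
    completes it ([lam_cycle], [lam_lollipop]). *)
Definition lam vs h := exists q b o ls,
  [/\ ol h q b, ol b o b, all evc ls & perm_eq vs (h :: q ++ b :: o ++ flatten ls)].

Lemma lam_lollipop vs h t b o : lam vs h -> niceu (vs ++ t ++ b :: o) ->
  el h t b -> ol b o b -> framed (h :: t ++ b :: o).
Proof.
case=> q [b' [o' [ls [lq lo ev pe]]]] n lt lb.
apply: (framedI (FrameBarbell (And3 lb (eo (elr lt) lq) lo)) n ev).
  by perm_count_with pe.
by move=> x; rewrite !(inE, mem_cat, mem_rev) => /or4P[]->; rewrite ?orbT.
Qed.

Lemma lam_cycle vs h r : lam vs h -> niceu (vs ++ r) -> ol h r h -> framed (h :: r).
Proof.
case=> q [b' [o' [ls [lq lo ev pe]]]] n lr.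
apply: (framedI (FrameBarbell (And3 lr lq lo)) n ev).
  by perm_count_with pe.
by move=> x; rewrite !(inE, mem_cat) => /orP[]->; rewrite ?orbT.
Qed.

Lemma lam_perm vs vs' h : perm_eq vs vs' -> lam vs h -> lam vs' h.
Proof.
move=> p [q [b [o [ls [lq lo ev pe]]]]]; exists q, b, o, ls; split=> //.
by rewrite perm_sym in p; apply: perm_trans p pe.
Qed.

Lemma barbell_lam b1 o1 q b2 o2 h : barbell b1 o1 q b2 o2 ->
  h \in barbell_seq b1 o1 q b2 o2 -> lam (barbell_seq b1 o1 q b2 o2) h.
Proof.
have half c1 p1 p c2 p2 : barbell c1 p1 p c2 p2 -> h \in c1 :: p1 ->
    lam (barbell_seq c1 p1 p c2 p2) h.
  case=> l1 l2 l3; rewrite inE => /predU1P[->|].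
    by exists p, c2, p2, [:: p1]; split; rewrite //= ?(evc_in l1) //; perm_count.
  case/mem_split=> m [s E]; move: l1; rewrite E => /ol_split[] [lc ld].
    exists (s ++ c1 :: p), c2, p2, [:: m]; split; rewrite ?(eo ld l2) //=.
      by rewrite (evc_in lc).
    by perm_count.
  exists (rev m ++ c1 :: p), c2, p2, [:: s]; split; rewrite ?(eo (elr lc) l2) //=.
    by rewrite (evc_in ld).
  by perm_count.
move=> bb; rewrite {1}/barbell_seq -cat_cons !mem_cat orbA orbAC -orbA.
have bb' := barbell_sym bb; have [l1 l2 l3] := bb.
case/or3P=> [||/mem_split[m [s E]]]; [exact: half| |].
  by move/(half _ _ _ _ _ bb'); apply: lam_perm; perm_count.
rewrite E in l2 *; case/ol_split: l2 => -[lc ld].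
  exists (rev m), b1, o1, [:: rcons s b2; o2]; split; rewrite ?(olr lc) //=.
    by rewrite (evc_r ld) (evc_in l3).
  by perm_count.
exists s, b2, o2, [:: b1 :: m; o1]; split; rewrite ?ld //=.
  by rewrite (evc_l lc) (evc_in l1).
by perm_count.
Qed.

(** * Subdivided K4: relabelling and odd ears *)

Definition k4_on vs a b c d ab ac ad bc bd cd :=
  k4 a b c d ab ac ad bc bd cd /\ perm_eq vs (k4_seq a b c d ab ac ad bc bd cd).

(** The three adjacent transpositions generate all relabellings of the branch vertices without
    changing [vs], so each relative position of the ends of an ear is treated for one labelling
    only. *)
Lemma k4_swap_ab vs a b c d ab ac ad bc bd cd :
  k4_on vs a b c d ab ac ad bc bd cd -> k4_on vs b a c d (rev ab) bc bd ac ad cd.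
Proof.
case=> -[[h1 h2 h3] [h4 h5 h6]] pe; split; last by perm_count_with pe.
by split; split=> //; apply: olr.
Qed.

Lemma k4_swap_bc vs a b c d ab ac ad bc bd cd :
  k4_on vs a b c d ab ac ad bc bd cd -> k4_on vs a c b d ac ab ad (rev bc) cd bd.
Proof.
case=> -[[h1 h2 h3] [h4 h5 h6]] pe; split; last by perm_count_with pe.
by split; split=> //; apply: olr.
Qed.

Lemma k4_swap_cd vs a b c d ab ac ad bc bd cd :
  k4_on vs a b c d ab ac ad bc bd cd -> k4_on vs a b d c ab ad ac bd bc (rev cd).
Proof.
case=> -[[h1 h2 h3] [h4 h5 h6]] pe; split; last by perm_count_with pe.
by split; split=> //; apply: olr.
Qed.

Lemma k4_mem vs a b c d ab ac ad bc bd cd x :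
  k4_on vs a b c d ab ac ad bc bd cd -> (x \in vs) =
  [|| x \in [:: a; b; c; d], x \in ab, x \in ac, x \in ad, x \in bc, x \in bd | x \in cd].
Proof. by case=> _ /perm_mem ->; rewrite /k4_seq !mem_cat. Qed.

Lemma k4_branch vs a b c d ab ac ad bc bd cd x :
  k4_on vs a b c d ab ac ad bc bd cd -> x \in [:: a; b; c; d] ->
  exists b c d ab ac ad bc bd cd, k4_on vs x b c d ab ac ad bc bd cd.
Proof.
move=> k; rewrite !inE => /or4P[]/eqP->.
- by do 9 eexists; apply: k.
- by do 9 eexists; apply: k4_swap_ab k.
- by do 9 eexists; apply: k4_swap_ab (k4_swap_bc k).
- by do 9 eexists; apply: k4_swap_ab (k4_swap_bc (k4_swap_cd k)).
Qed.

Lemma k4_interior vs a b c d ab ac ad bc bd cd x :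
  k4_on vs a b c d ab ac ad bc bd cd -> x \in vs -> x \notin [:: a; b; c; d] ->
  exists a b c d ab ac ad bc bd cd,
    k4_on vs a b c d ab ac ad bc bd cd /\ x \in ab.
Proof.
move=> k; rewrite (k4_mem _ k) => + /negPf E; rewrite {}E /=.
case/orP=> [i|/orP[i|/or4P[]i]].
- by do 10 eexists; split; [exact: k|].
- by do 10 eexists; split; [exact: k4_swap_bc k|].
- by do 10 eexists; split; [exact: k4_swap_bc (k4_swap_cd k)|].
- by do 10 eexists; split; [exact: k4_swap_bc (k4_swap_ab k)|].
- by do 10 eexists; split; [exact: k4_swap_bc (k4_swap_cd (k4_swap_ab k))|].
- by do 10 eexists; split;
    [exact: k4_swap_bc (k4_swap_cd (k4_swap_ab (k4_swap_bc k)))|].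
Qed.

Lemma k4_triangle vs a b c d ab ac ad bc bd cd :
  k4_on vs a b c d ab ac ad bc bd cd -> ol b (bc ++ c :: cd ++ d :: rev bd) b.
Proof. by case=> -[[_ _ _] [h4 h5 h6]] _; apply: oe h4 (oo h6 (olr h5)). Qed.

(** From a branch vertex, a path to another branch vertex is followed by the triangle avoiding the
    first. From the interior of [ab], the half of odd length leads to [a] or [b], and the triangle
    through that end, [c] and [d] serves as the cycle. *)
Lemma k4_lam vs a b c d ab ac ad bc bd cd h :
  k4_on vs a b c d ab ac ad bc bd cd -> h \in vs -> lam vs h.
Proof.
move=> k hv; have [i|i] := boolP (h \in [:: a; b; c; d]).
  have {a b c d ab ac ad bc bd cd k i}
    [b [c [d [ab [ac [ad [bc [bd [cd k]]]]]]]]] := k4_branch k i.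
  have [[[h1 h2 h3] [h4 h5 h6]] pe] := k.
  exists ab, b, (bc ++ c :: cd ++ d :: rev bd), [:: ac; ad].
  split; rewrite ?h1 ?(k4_triangle k) //= ?(evc_in h2) ?(evc_in h3) //.
  by perm_count_with pe.
have {a b c d ab ac ad bc bd cd k i}
  [a [b [c [d [ab [ac [ad [bc [bd [cd [k i]]]]]]]]]]] := k4_interior k hv i.
have [[[h1 h2 h3] [h4 h5 h6]] pe] := k.
case/mem_split: i => p [q E]; rewrite {}E in k h1 pe.
case/ol_split: h1 => -[lp lq].
  exists (rev p), a, (ac ++ c :: cd ++ d :: rev ad), [:: rcons q b; bc; bd].
  split; rewrite ?(olr lp) ?(k4_triangle (k4_swap_ab k)) //.
    by rewrite /= (evc_r lq) (evc_in h4) (evc_in h5).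
  by perm_count_with pe.
exists q, b, (bc ++ c :: cd ++ d :: rev bd), [:: a :: p; ac; ad].
split; rewrite ?lq ?(k4_triangle k) //.
  by rewrite /= (evc_l lp) (evc_in h2) (evc_in h3).
by perm_count_with pe.
Qed.

Section K4Ears.

Variables (vs : seq T).

Lemma k4_ear_branches a b c d ab ac ad bc bd cd r :
  k4_on vs a b c d ab ac ad bc bd cd -> niceu (vs ++ r) -> ol a r b -> framed r.
Proof.
case=> -[[h1 h2 h3] [h4 h5 h6]] pe n lr.
apply: (framedI (FrameK4 (conj (And3 lr h2 h3) (And3 h4 h5 h6))) n (ls := [:: ab])).
- by rewrite /= (evc_in h1).
- by perm_count_with pe.
- by sub_mem.
Qed.

(** If [h] is at odd distance from [a], the ear replaces the part of [ab] before [h]. Otherwise it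
    forms an odd cycle with that part, and the rest of [ab] joins this cycle to the triangle on [b],
    [c], [d]. *)
Lemma k4_ear_branch_incident a b c d ab ac ad bc bd cd r h :
  k4_on vs a b c d ab ac ad bc bd cd -> niceu (vs ++ r) -> ol a r h ->
  h \in ab -> framed r.
Proof.
move=> k n lr /mem_split[m [q E]]; rewrite {}E in k.
have [[[h1 h2 h3] [h4 h5 h6]] pe] := k.
case/ol_split: h1 => -[lm lq].
  apply: (framedI (FrameK4 (conj (And3 (oe lr lq) h2 h3) (And3 h4 h5 h6))) n (ls := [:: m])).
  - by rewrite /= (evc_in lm).
  - by perm_count_with pe.
  - by sub_mem.
apply: (framedI (FrameBarbell (And3 (eo (elr lm) lr) lq (k4_triangle k))) n
          (ls := [:: ac; ad])).
- by rewrite /= (evc_in h2) (evc_in h3).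
- by perm_count_with pe.
- by sub_mem.
Qed.

(** With [c] the end of [cd] at odd distance from [h], the vertex [h] takes over from [d] as branch
    vertex and the path [ad] is dropped. *)
Lemma k4_ear_branch_opposite a b c d ab ac ad bc bd cd r h :
  k4_on vs a b c d ab ac ad bc bd cd -> niceu (vs ++ r) -> ol a r h ->
  h \in cd -> framed r.
Proof.
have main c' d' ac' ad' bc' bd' p q : k4_on vs a b c' d' ab ac' ad' bc' bd' (p ++ h :: q) ->
    niceu (vs ++ r) -> ol a r h -> ol c' p h -> el h q d' -> framed r.
  move=> [[[h1 h2 h3] [h4 h5 h6]] pe] n lr lp lq.
  apply: (framedI (FrameK4 (conj (And3 h1 h2 lr) (And3 h4 (oe h5 (elr lq)) lp))) n
            (ls := [:: ad'])).
  - by rewrite /= (evc_in h3).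
  - by perm_count_with pe.
  - by sub_mem.
move=> k n lr /mem_split[p [q E]]; rewrite {}E in k.
have [[_ [_ _ l]] _] := k; case/ol_split: l => -[lp lq]; first exact: main k n lr lp lq.
have := k4_swap_cd k; rewrite rev_cat rev_cons cat_rcons => k'.
exact: main k' n lr (olr lq) (elr lp).
Qed.

Lemma k4_ear_same a b c d p h1 m h2 q ac ad bc bd cd r :
  k4_on vs a b c d (p ++ h1 :: m ++ h2 :: q) ac ad bc bd cd -> niceu (vs ++ r) ->
  ol h1 r h2 -> framed r.
Proof.
move=> k n lr; have [[[l1 l2 l3] [l4 l5 l6]] pe] := k.
have repl : ol a (p ++ h1 :: r ++ h2 :: q) b -> ol h1 m h2 -> framed r.
  move=> l lm.
  apply: (framedI (FrameK4 (conj (And3 l l2 l3) (And3 l4 l5 l6))) n (ls := [:: m])).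
  - by rewrite /= (evc_in lm).
  - by perm_count_with pe.
  - by sub_mem.
case/ol_split: l1 => -[lp]; [case/el_split|case/ol_split] => -[lm lq].
- by apply: repl lm; apply: oe lp (oo lr lq).
- apply: (framedI (FrameBarbell (And3 (k4_triangle (k4_swap_ab k)) lp (oe lr (elr lm)))) n
            (ls := [:: rcons q b; bc; bd])).
  + by rewrite /= (evc_r lq) (evc_in l4) (evc_in l5).
  + by perm_count_with pe.
  + by sub_mem.
- by apply: repl lm; apply: eo lp (oe lr lq).
- apply: (framedI (FrameBarbell (And3 (oe (olr lr) lm) lq (k4_triangle k))) n
            (ls := [:: a :: p; ac; ad])).
  + by rewrite /= (evc_l lp) (evc_in l2) (evc_in l3).
  + by perm_count_with pe.
  + by sub_mem.
Qed.

(** The parities of the distances from [a] decide. Both odd: K4 on [a], [h1], [h2], [d]. One odd and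
    one even: K4 on [b], [c], [d] and the end at even distance. Both even: the ear closes an odd
    cycle through [a], joined from [h1] to the triangle on [b], [c], [d]. *)
Lemma k4_ear_adjacent a b c d ab ac ad bc bd cd r h1 h2 :
  k4_on vs a b c d ab ac ad bc bd cd -> niceu (vs ++ r) -> ol h1 r h2 ->
  h1 \in ab -> h2 \in ac -> framed r.
Proof.
have mixed a' b' c' d' p q s t ad' bc' bd' cd' g1 g2 r' :
    k4_on vs a' b' c' d' (p ++ g1 :: q) (s ++ g2 :: t) ad' bc' bd' cd' ->
    niceu (vs ++ r') -> ol g1 r' g2 -> ol a' p g1 -> el g1 q b' -> el a' s g2 ->
    ol g2 t c' -> framed r'.
  move=> [[[l1 l2 l3] [l4 l5 l6]] pe] n lr lp lq ls lt.
  have k2 : k4 b' c' d' g2 bc' bd' (rev q ++ g1 :: r') cd' (rev t) (rev ad' ++ a' :: s).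
    by split; split=> //; [exact: eo (elr lq) lr | exact: olr | exact: oe (olr l3) ls].
  apply: (framedI (FrameK4 k2) n (ls := [:: p])).
  - by rewrite /= (evc_in lp).
  - by perm_count_with pe.
  - by sub_mem.
move=> k n lr /mem_split[p [q E1]] /mem_split[s [t E2]]; rewrite {}E1 {}E2 in k.
have [[[l1 l2 l3] [l4 l5 l6]] pe] := k.
case/ol_split: l1 => -[lp lq]; case/ol_split: l2 => -[ls lt].
- have k2 : k4 a h1 h2 d p s ad r (q ++ b :: bd) (t ++ c :: cd).
    by split; split=> //; [exact: eo lq l5 | exact: eo lt l6].
  apply: (framedI (FrameK4 k2) n (ls := [:: bc])).
  + by rewrite /= (evc_in l4).
  + by perm_count_with pe.
  + by sub_mem.
- exact: mixed k n lr lp lq ls lt.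
- apply: framed_rev.
  apply: mixed (k4_swap_bc k) _ (olr lr) ls lt lp lq.
  by apply: niceu_perm n; rewrite perm_cat2l perm_sym perm_rev.
- apply: (framedI (FrameBarbell
    (And3 (eo (elr lp) (eo ls (olr lr))) lq (k4_triangle k))) n (ls := [:: t; ad])).
  + by rewrite /= (evc_in lt) (evc_in l3).
  + by perm_count_with pe.
  + by sub_mem.
Qed.

(** After relabelling, [h1] is at odd distance from [a] and [h2] from [c]; then [a], [c], [h1], [h2]
    are the branch vertices of a new K4 in which [bd] is dropped. *)
Lemma k4_ear_opposite a b c d ab ac ad bc bd cd r h1 h2 :
  k4_on vs a b c d ab ac ad bc bd cd -> niceu (vs ++ r) -> ol h1 r h2 ->
  h1 \in ab -> h2 \in cd -> framed r.
Proof.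
have main a' b' c' d' p q s t ac' ad' bc' bd' :
    k4_on vs a' b' c' d' (p ++ h1 :: q) ac' ad' bc' bd' (s ++ h2 :: t) ->
    niceu (vs ++ r) -> ol h1 r h2 -> ol a' p h1 -> el h1 q b' -> ol c' s h2 ->
    el h2 t d' -> framed r.
  move=> [[[l1 l2 l3] [l4 l5 l6]] pe] n lr lp lq ls lt.
  have k2 : k4 a' c' h1 h2 ac' p (ad' ++ d' :: rev t) (rev bc' ++ b' :: rev q) s r.
    by split; split=> //; [exact: oe l3 (elr lt) | exact: oe (olr l4) (elr lq)].
  apply: (framedI (FrameK4 k2) n (ls := [:: bd'])).
  - by rewrite /= (evc_in l5).
  - by perm_count_with pe.
  - by sub_mem.
move=> k n lr /mem_split[p [q E1]] /mem_split[s [t E2]]; rewrite {}E1 {}E2 in k.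
have [[[l1 l2 l3] [l4 l5 l6]] pe] := k.
have revE (x : T) u v : rev (u ++ x :: v) = rev v ++ x :: rev u.
  by rewrite rev_cat rev_cons cat_rcons.
case/ol_split: l1 => -[lp lq]; case/ol_split: l6 => -[ls lt].
- exact: main k n lr lp lq ls lt.
- have := k4_swap_cd k; rewrite revE => k'.
  exact: main k' n lr lp lq (olr lt) (elr ls).
- have := k4_swap_ab k; rewrite revE => k'.
  exact: main k' n lr (olr lq) (elr lp) ls lt.
- have := k4_swap_cd (k4_swap_ab k); rewrite !revE => k'.
  exact: main k' n lr (olr lq) (elr lp) (olr lt) (elr ls).
Qed.

Lemma k4_ear_branch a b c d ab ac ad bc bd cd r h :
  k4_on vs a b c d ab ac ad bc bd cd -> niceu (vs ++ r) -> ol a r h ->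
  a != h -> h \in vs -> framed r.
Proof.
move=> k n lr ah; rewrite (k4_mem _ k) !inE eq_sym (negPf ah) /=.
case/or4P=> [/or3P[]/eqP E|i|i|/or4P[]i]; try rewrite {}E in lr.
- exact: k4_ear_branches k n lr.
- exact: k4_ear_branches (k4_swap_bc k) n lr.
- exact: k4_ear_branches (k4_swap_bc (k4_swap_cd k)) n lr.
- exact: k4_ear_branch_incident k n lr i.
- exact: k4_ear_branch_incident (k4_swap_bc k) n lr i.
- exact: k4_ear_branch_incident (k4_swap_bc (k4_swap_cd k)) n lr i.
- by apply: (k4_ear_branch_opposite (k4_swap_cd (k4_swap_bc (k4_swap_cd k))) n lr);
    rewrite mem_rev.
- exact: k4_ear_branch_opposite (k4_swap_bc k) n lr i.
- exact: k4_ear_branch_opposite k n lr i.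
Qed.

Lemma k4_ear a b c d ab ac ad bc bd cd r h1 h2 :
  k4_on vs a b c d ab ac ad bc bd cd -> niceu (vs ++ r) -> ol h1 r h2 ->
  h1 != h2 -> h1 \in vs -> h2 \in vs -> framed r.
Proof.
move=> k n lr h12 h1v h2v.
have n' : niceu (vs ++ rev r).
  by apply: niceu_perm n; rewrite perm_cat2l perm_sym perm_rev.
have h21 : h2 != h1 by rewrite eq_sym.
have [i|i] := boolP (h1 \in [:: a; b; c; d]).
  have [b' [c' [d' [ab' [ac' [ad' [bc' [bd' [cd' k']]]]]]]]] := k4_branch k i.
  exact: k4_ear_branch k' n lr h12 h2v.
have {a b c d ab ac ad bc bd cd k i}
  [a [b [c [d [ab [ac [ad [bc [bd [cd [k i]]]]]]]]]]] := k4_interior k h1v i.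
have [j|j] := boolP (h2 \in [:: a; b; c; d]).
  have [b' [c' [d' [ab' [ac' [ad' [bc' [bd' [cd' k']]]]]]]]] := k4_branch k j.
  by apply: framed_rev; exact: k4_ear_branch k' n' (olr lr) h21 h1v.
have i' : h1 \in rev ab by rewrite mem_rev.
move: h2v; rewrite (k4_mem _ k) (negPf j) => /or4P[]//.
- move=> i2; have [p1 [m [s [E|E]]]] := mem_split2 i i2 h12; rewrite {}E in k.
    exact: k4_ear_same k n lr.
  by apply/framed_rev; exact: k4_ear_same k n' (olr lr).
- exact: k4_ear_adjacent k n lr i.
case/or4P=> i2.
- exact: k4_ear_adjacent (k4_swap_cd k) n lr i i2.
- exact: k4_ear_adjacent (k4_swap_ab k) n lr i' i2.
- exact: k4_ear_adjacent (k4_swap_cd (k4_swap_ab k)) n lr i' i2.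
- exact: k4_ear_opposite k n lr i i2.
Qed.

End K4Ears.

Lemma frame_lam vs h : sd_frame vs -> h \in vs -> lam vs h.
Proof.
case=> [b1 o1 q b2 o2|a b c d ab ac ad bc bd cd]; first exact: barbell_lam.
by move=> k; apply: k4_lam (conj k (perm_refl _)).
Qed.

Lemma frame_ear vs h1 h2 r : sd_frame vs -> niceu (vs ++ r) -> ol h1 r h2 ->
  h1 != h2 -> h1 \in vs -> h2 \in vs -> framed r.
Proof.
case=> [b1 o1 q b2 o2|a b c d ab ac ad bc bd cd] k n lr h12.
  exact: barbell_ear k n lr h12.
exact: k4_ear (conj k (perm_refl _)) n lr h12.
Qed.

(** * Theta graphs with two even paths and one odd path *)

Definition theta x1 x2 a1 a2 c := [/\ el x1 a1 x2, el x1 a2 x2 & ol x1 c x2].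

Definition theta_seq x1 x2 a1 a2 (c : seq T) := x1 :: x2 :: a1 ++ a2 ++ c.

Lemma theta_cycle x1 x2 a1 a2 c : theta x1 x2 a1 a2 c -> ol x1 (a2 ++ x2 :: rev c) x1.
Proof. by case=> _ l2 l3; apply: eo l2 (olr l3). Qed.

Lemma theta_lam x1 x2 p y s a2 c : theta x1 x2 (p ++ y :: s) a2 c ->
  ol x1 p y -> ol y s x2 -> lam (theta_seq x1 x2 (p ++ y :: s) a2 c) y.
Proof.
move=> th lp ls; exists (rev p), x1, (a2 ++ x2 :: rev c), [:: s].
split; rewrite ?(olr lp) ?(theta_cycle th) //= ?(evc_in ls) //.
by perm_count.
Qed.

Lemma theta_ear_same x1 x2 p y m z s a2 c r :
  theta x1 x2 (p ++ y :: m ++ z :: s) a2 c ->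
  niceu (theta_seq x1 x2 (p ++ y :: m ++ z :: s) a2 c ++ r) ->
  ol x1 p y -> el y m z -> ol z s x2 -> ol y r z -> framed (y :: r).
Proof.
move=> th n lp lm ls lr.
apply: (framedI (FrameBarbell (And3 (oe lr (elr lm)) (olr lp) (theta_cycle th))) n
          (ls := [:: s])).
- by rewrite /= (evc_in ls).
- by perm_count.
- by move=> x; rewrite !(inE, mem_cat) => /orP[]->; rewrite ?orbT.
Qed.

(** The ear cuts both even paths into odd halves, so [x1], [x2], [y], [z] are the branch vertices of
    a K4. *)
Lemma theta_ear_cross x1 x2 p y s p' z s' c r :
  theta x1 x2 (p ++ y :: s) (p' ++ z :: s') c ->
  niceu (theta_seq x1 x2 (p ++ y :: s) (p' ++ z :: s') c ++ r) ->
  ol x1 p y -> ol y s x2 -> ol x1 p' z -> ol z s' x2 -> ol y r z -> framed (y :: r).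
Proof.
move=> [_ _ lc] n lp ls lp' ls' lr.
have k : k4 x1 x2 y z c p p' (rev s) (rev s') r by split; split=> //; apply: olr.
apply: (framedI (FrameK4 k) n (ls := [::])) => //; first by perm_count.
by move=> x; rewrite !(inE, mem_cat) => /orP[]->; rewrite ?orbT.
Qed.

(** The vertex [z] cuts [c] into an odd and an even half. The odd half becomes the new odd path, the
    even half prolongs [a2], and the ear together with one half of the first path is the other even
    path. *)
Lemma theta_ear_shorten x1 x2 p y s a2 c z r :
  theta x1 x2 (p ++ y :: s) a2 c ->
  niceu (theta_seq x1 x2 (p ++ y :: s) a2 c ++ r) ->
  ol x1 p y -> ol y s x2 -> z \in c -> ol y r z ->
  exists x1' x2' a1' a2' c', [/\ theta x1' x2' a1' a2' c',
    niceu (theta_seq x1' x2' a1' a2' c'), size c' < size c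
    & {subset theta_seq x1' x2' a1' a2' c' <= theta_seq x1 x2 (p ++ y :: s) a2 c ++ r}].
Proof.
move=> [la lb lc] n lp ls /mem_split[c1 [c2 E]] lr; rewrite {}E in lc n *.
have {}main x1' x2' a1' a2' c' t : theta x1' x2' a1' a2' c' -> evc t ->
    size c' < size (c1 ++ z :: c2) ->
    perm_eq (theta_seq x1 x2 (p ++ y :: s) a2 (c1 ++ z :: c2) ++ r)
      (theta_seq x1' x2' a1' a2' c' ++ t) ->
    exists x1' x2' a1' a2' c', [/\ theta x1' x2' a1' a2' c',
      niceu (theta_seq x1' x2' a1' a2' c'), size c' < size (c1 ++ z :: c2)
      & {subset theta_seq x1' x2' a1' a2' c' <=
         theta_seq x1 x2 (p ++ y :: s) a2 (c1 ++ z :: c2) ++ r}].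
  move=> th ev lt pe; exists x1', x2', a1', a2', c'; split=> //.
    split.
      by case: n; rewrite (perm_uniq pe) cat_uniq => /andP[].
    have ev' : all evc [:: t] by rewrite /= ev.
    by apply: (nice_rm esym ev' n.1 n.2); rewrite /= cats0.
  by move=> x xt; rewrite (perm_mem pe) mem_cat xt.
case/ol_split: lc => -[l1 l2].
  apply: (main x1 z (a2 ++ x2 :: rev c2) (p ++ y :: r) c1 s).
  - by split; [exact: ee lb (elr l2)|exact: oo lp lr|].
  - exact: evc_in ls.
  - by rewrite size_cat /= addnS ltnS leq_addr.
  - by perm_count.
apply: (main x2 z (rev a2 ++ x1 :: c1) (rev s ++ y :: r) (rev c2) p).
- by split; [exact: ee (elr lb) l1|exact: oo (olr ls) lr|exact: olr].
- exact: evc_in lp.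
- by rewrite size_cat size_rev /= addnS ltnS leq_addl.
- by perm_count.
Qed.

End Structures.

(** * Half-integral covers and alternating walks *)

Section Covers.

Variables (T : finType) (e : rel T).
Hypothesis esym : symmetric e.

Notation ol := (klink e false).
Notation el := (klink e true).

(** Halving [f] gives a fractional vertex cover of weight at most half the number of vertices, which
    is optimal if there is a perfect matching. *)
Definition half_cover (f : T -> nat) :=
  (forall a b, e a b -> 2 <= f a + f b) /\ \sum_x f x <= #|T|.

Definition central v := forall f, half_cover f -> f v = 1.

(** * Alternating walks as paths in a skew-symmetric digraph *)

Section Involution.

Variable s : T -> T.
Hypothesis sP : pmf e [set: T] s.

Lemma pmfK : involutive s.
Proof. by move=> x; have [] := sP (in_setT x). Qed.

Lemma pmf_neq x : s x != x.
Proof. by have [] := sP (in_setT x). Qed.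

Lemma pmf_edge x : e x (s x).
Proof. by have [] := sP (in_setT x). Qed.

Lemma pmf_sum (f : T -> nat) : \sum_x f (s x) = \sum_x f x.
Proof. by rewrite [RHS](reindex_inj (inv_inj pmfK)). Qed.

(** Complementary slackness: summed over all [x], the left side is twice the weight of [f], hence at
    most 2 per vertex, while each single term is at least 2. *)
Lemma half_cover_pair f x : half_cover f -> f x + f (s x) = 2.
Proof.
case=> fe fs.
have le y : y \in T -> 2 <= f y + f (s y) ?= iff (2 == f y + f (s y)).
  by move=> _; apply/leqif_eq/fe/pmf_edge.
have /leqifP := leqif_sum le; rewrite sum_nat_const big_split /= pmf_sum.
case: ifP => [/forallP/(_ x)/implyP/(_ isT)/eqP <- //|_].
by rewrite ltnNge muln2 -addnn leq_add.
Qed.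

(** Two steps of an alternating walk: an edge to [s w], then the matching edge to [w]. As in the
    implication graph of 2-SAT, [s] reverses all arcs ([arc_conj]), and every half cover is
    non-increasing along arcs ([arc_le]). *)
Definition arc u w := e u (s w).

Lemma arc_conj u w : arc u w = arc (s w) (s u).
Proof. by rewrite /arc pmfK esym. Qed.

Lemma connect_arc_conj u w : connect arc u w -> connect arc (s w) (s u).
Proof.
case/connectP=> p + ->; elim: p u => //= x p IH u /andP[ux /IH h].
by apply: connect_trans h _; apply: connect1; rewrite -arc_conj.
Qed.

Lemma arc_le f u w : half_cover f -> arc u w -> f w <= f u.
Proof. by move=> fc uw; have := half_cover_pair w fc; have := fc.1 _ _ uw; clear; lia. Qed.

Lemma arc_path_le f y p x : half_cover f -> path arc y p -> x \in y :: p ->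
  f x <= f y /\ f (last y p) <= f x.
Proof.
move=> fc; elim: p y x => [|z p IH] y x /=; first by rewrite inE => _ /eqP->.
move=> /andP[yz zp]; have [h1 h2] := IH z z zp (mem_head _ _).
have h := arc_le fc yz; rewrite inE => /predU1P[->|/(IH _ _ zp)[]]; move: h1 h2 h; clear; lia.
Qed.

Definition flat p := flatten [seq [:: s x; x] | x <- p].

Lemma flat_path y p : path arc y p -> path e y (flat p).
Proof.
elim: p y => //= x p IH y /andP[yx /IH h]; by rewrite -/(arc y x) yx esym pmf_edge.
Qed.

Lemma last_flat y p : last y (flat p) = last y p.
Proof. by elim: p y => //= x p IH y. Qed.

Lemma size_flat p : odd (size (flat p)) = false.
Proof. by elim: p => //= x p ->. Qed.

Lemma flat_cat p q : flat (p ++ q) = flat p ++ flat q.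
Proof. by rewrite /flat map_cat flatten_cat. Qed.

Lemma mem_flat x p : (x \in flat p) = (x \in p) || (s x \in p).
Proof.
elim: p => //= y p IH; rewrite !inE IH (can2_eq pmfK pmfK).
by case: (x == y); case: (s x == y); case: (x \in p); rewrite ?orbT.
Qed.

Lemma uniq_flat p : uniq p -> {in p &, forall a b, s a != b} -> uniq (flat p).
Proof.
elim: p => //= x p IH /andP[xp up] cf.
have sxp : s x \notin p.
  apply/negP=> h; have := cf x (s x); rewrite !inE h eqxx orbT => /(_ isT isT).
  by rewrite eqxx.
rewrite !inE !mem_flat pmfK negb_or pmf_neq (negPf xp) (negPf sxp) /= IH //.
by move=> a b ap bp; apply: cf; rewrite inE ?ap ?bp orbT.
Qed.

(** A repetition-free path of arcs expands to a simple path unless it meets both a vertex and its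
    partner. At the first such meeting the expanded walk closes up at [a], which gives a
    lollipop. *)
Lemma first_conj p : {in p &, forall a b, s a != b} \/
  exists p1 a p2 p3, p = p1 ++ a :: p2 ++ s a :: p3 /\
    {in p1 ++ a :: p2 &, forall a b, s a != b}.
Proof.
elim/last_ind: p => [|p c [cf|]]; first by left.
  have [i|i] := boolP (s c \in p).
    right; have [p1 [p2 E]] := mem_split i.
    exists p1, (s c), p2, [::]; rewrite pmfK -E; split=> //.
    by rewrite E -cats1 -catA.
  left=> a b; rewrite !mem_rcons !inE => /predU1P[->|ap] /predU1P[->|bp].
  - exact: pmf_neq.
  - by apply: contraNneq i => ->.
  - by apply: contraNneq i => <-; rewrite pmfK.
  - exact: cf.
case=> [p1 [a [p2 [p3 [-> cf]]]]]; right; exists p1, a, p2, (rcons p3 c).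
by split=> //; rewrite -!cats1 -!catA /= -!catA.
Qed.

(** Let [R] be reachable from [Y] by arcs avoiding [Th]. If no arc from [R] enters [Th] outside [Y],
    then [R] is closed under arcs and contains no vertex together with its partner, and it supports
    a half cover that vanishes at [y0]. *)
Lemma escape_arc (Th Y : {set T}) y0 :
    (forall x, x \in Th -> s x \in Th) -> Y \subset Th ->
    (forall y, y \in Y -> s y \notin Y) -> y0 \in Y -> central y0 ->
  exists y p x, [/\ y \in Y, path arc y p, uniq p,
    forall z, z \in p -> z \notin Th & [/\ arc (last y p) x, x \in Th & x \notin Y]].
Proof.
move=> Thc YTh Ys y0Y cy0.
pose off u w := arc u w && (w \notin Th).
pose R := [set w | [exists y in Y, connect off y w]].
suff [w [x [wR wx xTh xY]]] :
    exists w x, [/\ w \in R, arc w x, x \in Th & x \notin Y].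
  move: wR; rewrite inE => /exists_inP[y yY /connectP[p yp wE]].
  case/shortenP: yp wE => p' yp' /andP[_ up'] _ wE.
  exists y, p', x; split=> //; last by rewrite -wE.
    by apply: sub_path yp' => a b /andP[].
  move=> z zp; move: yp'; rewrite (eq_path (e' := fun a b => arc a b && (b \notin Th))) //.
  elim: p' y {yY wE up'} zp => //= b p' IH y; rewrite inE.
  by case/predU1P=> [->|zp] /andP[/andP[_ h] h'] //; apply: IH zp h'.
apply: contrapT => none.
have Rc w z : w \in R -> arc w z -> z \in R.
  move=> wR wz; have [zY|zY] := boolP (z \in Y).
    by rewrite inE; apply/exists_inP; exists z.
  have zT : z \notin Th by apply/negP=> zT; apply: none; exists w, z.
  move: wR; rewrite !inE => /exists_inP[y yY yw]; apply/exists_inP; exists y => //.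
  by apply: connect_trans yw _; apply: connect1; rewrite /off wz.
have RT w : w \in R -> w \in Th -> w \in Y.
  rewrite inE => /exists_inP[y yY /connectP[p + ->]].
  case/lastP: p => //= p z; rewrite rcons_path last_rcons => /andP[_ /andP[_ /negPf->]] //.
have Rc' w z : w \in R -> connect arc w z -> z \in R.
  move=> wR /connectP[p + ->]; elim: p w wR => //= x p IH w wR /andP[wx].
  exact/IH/(Rc w).
(* Conjugating a path from [y] to [s w] gives one from [w] to [s y], so [s y] would be in [R] and in
   [Th], hence in [Y]. *)
have Rs w : w \in R -> s w \notin R.
  move=> wR; apply/negP; rewrite inE => /exists_inP[y yY ysw].
  have ysw' : connect arc y (s w).
    by apply: connect_sub ysw => a b /andP[ab _]; apply: connect1.
  have := Rc' _ _ wR; rewrite -{1}(pmfK w) => /(_ _ (connect_arc_conj ysw')) syR.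
  have := Ys _ yY; rewrite (RT _ syR) // Thc //.
  by apply: (subsetP YTh).
pose f w := if w \in R then 0 else if s w \in R then 2 else 1.
have y0R : y0 \in R by rewrite inE; apply/exists_inP; exists y0.
have fp w : f w + f (s w) = 2.
  rewrite /f pmfK; have := Rs w.
  by case: ifP => // wR; [move/(_ isT)/negPf-> | case: ifP].
suff fc : half_cover f by have := cy0 f fc; rewrite /f y0R.
split.
  have half a b : e a b -> a \in R -> f b = 2.
    move=> ab aR; have sbR : s b \in R by apply: Rc aR _; rewrite /arc pmfK.
    have := Rs _ sbR; rewrite pmfK => bR.
    by rewrite /f (negPf bR) sbR.
  move=> a b ab; have [aR|aR] := boolP (a \in R).
    by rewrite (half a b ab aR) addn2.
  have [bR|bR] := boolP (b \in R).
    by rewrite esym in ab; rewrite (half b a ab bR) leq_addr.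
  by rewrite /f (negPf aR) (negPf bR); do 2 case: ifP => // _.
have : \sum_x (f x + f (s x)) = 2 * #|T|.
  by under eq_bigr => x _ do rewrite fp; rewrite sum_nat_const mulnC.
by rewrite big_split /= pmf_sum addnn -mul2n => /eqP; rewrite eqn_pmul2l // => /eqP->.
Qed.

(** The last arc passes [z] and ends in its partner; it is that endpoint, [s z], that avoids [Y].
    Weights on the ear are squeezed between those of its ends, so its centrality depends on that of
    [z]. *)
Definition ear_from (Th Y : {set T}) y r z :=
  [/\ ol y r z, uniq r, forall x, x \in r -> x \notin Th,
    forall x, x \in r -> s x \in r &
    [/\ z \in Th, s z \notin Y & central z -> forall x, x \in r -> central x]].

Definition lollipop_from (Th : {set T}) y t b o :=
  [/\ el y t b, ol b o b, uniq (t ++ b :: o),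
    forall x, x \in t ++ b :: o -> x \notin Th &
    (forall x, x \in t ++ b :: o -> s x \in t ++ b :: o) /\
    (forall x, x \in t ++ b :: o -> central x)].

Lemma flat_link y p x : path arc y p -> e (last y p) x -> ol y (flat p) x.
Proof.
by move=> yp ex; rewrite /klink /link rcons_path flat_path // last_flat ex size_flat.
Qed.

(** The arc path of [escape_arc] is cut by [first_conj]. Weights decrease along it from the value 1
    at [y]; on a lollipop they pass from [a] to [s a], and as these two sum to 2 every weight is
    1. *)
Lemma escape (Th Y : {set T}) y0 :
    (forall x, x \in Th -> s x \in Th) -> Y \subset Th ->
    (forall y, y \in Y -> s y \notin Y) -> y0 \in Y ->
    (forall y, y \in Y -> central y) ->
  exists2 y, y \in Y & (exists r z, ear_from Th Y y r z) \/
                       (exists t b o, lollipop_from Th y t b o).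
Proof.
move=> Thc YTh Ys y0Y cY.
have [y [p [x [yY yp up pT [lx xT xY]]]]] := escape_arc Thc YTh Ys y0Y (cY _ y0Y).
exists y => //.
have flat_off q : {subset q <= p} -> forall z, z \in flat q -> z \notin Th.
  move=> sub z; rewrite mem_flat => /orP[/sub/pT //|/sub/pT].
  by apply: contra => /Thc.
have flat_closed q z : z \in flat q -> s z \in flat q.
  by rewrite !mem_flat pmfK orbC.
case: (first_conj p) => [cf|[p1 [a [p2 [p3 [pE cf]]]]]]; [left|right].
  exists (flat p), (s x); split=> //.
  - exact: flat_link.
  - exact: uniq_flat.
  - exact: flat_off.
  - exact: flat_closed.
  - split; rewrite ?pmfK ?Thc // => cz w wp f fc.
    have fx := half_cover_pair x fc; rewrite cz // in fx.
    have fy := cY _ yY _ fc; have lf := arc_le fc lx.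
    have main u : u \in p -> f u = 1.
      by move=> up'; have := @arc_path_le f y p u fc yp; rewrite inE up' orbT => /(_ isT); move: fx fy lf; clear; lia.
    move: wp; rewrite mem_flat => /orP[/main //|/main h].
    by have := half_cover_pair w fc; move: h; clear; lia.
have [yp1 ap2 la] : [/\ path arc y p1, arc (last y p1) a /\ path arc a p2 & arc (last a p2) (s a)].
  by move: yp; rewrite pE cat_path /= cat_path /= => /and5P[].
have sub : {subset p1 ++ a :: p2 <= p}.
  by move=> z; rewrite pE !(mem_cat, inE); case/or3P=> ->; rewrite ?orbT.
exists (flat p1 ++ [:: s a]), a, (flat p2).
have E : (flat p1 ++ [:: s a]) ++ a :: flat p2 = flat (p1 ++ a :: p2).
  by rewrite flat_cat /= -catA.
rewrite /lollipop_from E; split.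
- rewrite -[true]/(~~ (false (+) false)); apply: klink_cat.
    by apply: flat_link => //; case: ap2.
  by apply: klink_nil; rewrite esym pmf_edge.
- by apply: flat_link ap2.2 _; move: la; rewrite /arc pmfK.
- apply: uniq_flat => //; apply: subseq_uniq up; rewrite pE.
  by rewrite -cat_cons catA prefix_subseq.
- exact: flat_off.
- split; first exact: flat_closed.
  move=> w wp f fc.
  have yq : path arc y (p1 ++ a :: p2) by rewrite cat_path /= yp1 ap2.1 ap2.2.
  have fy := cY _ yY _ fc; have fl := arc_le fc la; have fa := half_cover_pair a fc.
  have main u : u \in p1 ++ a :: p2 -> f u = 1.
    have aq : a \in y :: p1 ++ a :: p2 by rewrite !(inE, mem_cat) eqxx !orbT.
    have := arc_path_le fc yq aq; rewrite last_cat /= => ha up'.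
    have uq : u \in y :: p1 ++ a :: p2 by rewrite inE up' orbT.
    by have := arc_path_le fc yq uq; rewrite last_cat /=; move: fy fl fa ha; clear; lia.
  move: wp; rewrite mem_flat => /orP[/main //|/main h].
  by have := half_cover_pair w fc; move: h; clear; lia.
Qed.

Lemma central_s v : central v -> central (s v).
Proof. by move=> c f fc; have := half_cover_pair v fc; rewrite c // => -[]. Qed.

End Involution.

End Covers.

(** * Frames through central vertices *)

Section Central.

Variables (T : finType) (e : rel T).
Hypothesis esym : symmetric e.

Notation ol := (klink e false).
Notation el := (klink e true).
Notation central := (central e).
Notation niceu := (niceu e).
Notation framed := (framed e).
Notation theta := (theta e).
Notation pmf := (pmf e [set: T]).
Notation evc := (evc e).

Fixpoint fsts (l : seq T) := if l is x :: y :: l' then x :: fsts l' else [::].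
Fixpoint snds (l : seq T) := if l is x :: y :: l' then y :: snds l' else [::].

Lemma fsts_split l x : x \in fsts l ->
  exists p q, l = p ++ x :: q /\ ~~ odd (size p).
Proof.
elim/seq_pair_ind: l => //= a b l IH; rewrite inE => /predU1P[->|/IH].
  by exists [::], (b :: l).
by case=> p [q [-> h]]; exists [:: a, b & p], q; rewrite /= negbK.
Qed.

Lemma snds_split l x : x \in snds l -> exists p q, l = p ++ x :: q /\ odd (size p).
Proof.
elim/seq_pair_ind: l => //= a b l IH; rewrite inE => /predU1P[->|/IH].
  by exists [:: a], l.
by case=> p [q [-> h]]; exists [:: a, b & p], q; rewrite /= negbK.
Qed.

Lemma mem_fsts l x : x \in fsts l -> x \in l.
Proof. by case/fsts_split=> p [q [-> _]]; rewrite mem_cat mem_head orbT. Qed.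

Lemma mem_snds l x : x \in snds l -> x \in l.
Proof. by case/snds_split=> p [q [-> _]]; rewrite mem_cat mem_head orbT. Qed.

Lemma fsts_snds l x : uniq l -> x \in fsts l -> x \notin snds l.
Proof.
elim/seq_pair_ind: l => //= a b l IH.
rewrite !inE negb_or => /and3P[/andP[ab al] bl ul].
case/predU1P=> [->|xl]; rewrite !negb_or.
  by rewrite ab; apply: contra al; apply: mem_snds.
by rewrite IH // andbT; apply: contraNneq bl => <-; apply: mem_fsts.
Qed.

Lemma paired_fsts_snds s l x : paired s l -> x \in l ->
  (x \in fsts l /\ s x \in snds l) \/ (x \in snds l /\ s x \in fsts l).
Proof.
elim/seq_pair_ind: l => //= a b l IH [sa sb pl].
rewrite !inE => /or3P[/eqP->|/eqP->|/(IH pl)[[-> ->]|[-> ->]]];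
  rewrite ?sa ?sb ?eqxx ?orbT; by [left|right].
Qed.

Lemma niceu_ear s W r : pmf s -> uniq W -> (forall x, x \in W -> s x \in W) ->
  uniq r -> (forall x, x \in r -> x \notin W) -> (forall x, x \in r -> s x \in r) ->
  niceu (W ++ r).
Proof.
move=> sP uW cW ur off cr; split.
  by rewrite cat_uniq uW ur andbT -all_predC; apply/allP=> x /off.
apply: nice_closed sP _ => x; rewrite !mem_cat.
by case/orP=> [/cW|/cr] ->; rewrite ?orbT.
Qed.

Lemma framed1 y r : framed (y :: r) -> framed [:: y].
Proof.
case=> vs [f n sub]; exists vs; split=> // x; rewrite inE => /eqP->.
exact/sub/mem_head.
Qed.

Lemma frame_evc vs : sd_frame e vs ->
  exists ls, all evc ls /\ perm_eq vs (flatten ls).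
Proof.
case=> [b1 o1 q b2 o2 [h1 h2 h3]|a b c d ab ac ad bc bd cd [[h1 h2 h3] [h4 h5 h6]]].
  exists [:: o1; b1 :: rcons q b2; o2].
  by rewrite /= (evc_in h1) (evc_in h3) (evc_lr h2); split=> //; perm_count.
exists [:: a :: rcons ab b; c :: rcons cd d; ac; ad; bc; bd].
rewrite /= (evc_in h2) (evc_in h3) (evc_in h4) (evc_in h5) (evc_lr h1) (evc_lr h6).
by split=> //; perm_count.
Qed.

(** A perfect matching of the whole graph can be chosen that pairs prescribed chains of [W]
    consecutively, and so does not leave [W]. *)
Lemma niceu_total W ls : all evc ls -> niceu W -> perm_eq W (flatten ls) ->
  exists s, [/\ pmf s, forall l, l \in ls -> paired s l &
                forall x, x \in W -> s x \in W].
Proof.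
move=> ev n pe; have [u n'] := niceu_perm pe n.
have [s [sP sl]] := nice_total esym ev u n'; exists s; split=> // x.
rewrite !(perm_mem pe) => /flattenP[l lls xl]; apply/flattenP; exists l => //.
exact: paired_closed (sl _ lls) _ xl.
Qed.

(* An M-alternating walk leaving a frame through [u] and the partner of [u] can *)
(* only come back to the frame, which makes an ear, or close up on itself.      *)
Lemma framed_adj h u : framed [:: h] -> e h u -> central u -> framed [:: u].
Proof.
case=> vs [fr n sub] hu cu.
have hv : h \in vs by apply: sub; rewrite mem_head.
have [uv|uv] := boolP (u \in vs).
  by exists vs; split=> // x; rewrite inE => /eqP->.
have [ls [ev pe]] := frame_evc fr.
have [s [sP _ sv]] := niceu_total ev n pe.
have ss := pmfK sP; have suN := pmf_neq sP u.
have suv : s u \notin vs by apply: contra uv => /sv; rewrite ss.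
pose W := u :: s u :: vs.
have uW : uniq W by rewrite /= !inE negb_or eq_sym suN uv suv n.1.
have cW x : x \in W -> s x \in W.
  by rewrite !inE => /or3P[/eqP->|/eqP->|/sv->]; rewrite ?ss ?eqxx ?orbT.
have lam := frame_lam esym fr hv.
have eus : e u (s u) := pmf_edge sP u.
have l1 : el h [:: u] (s u) by apply: (oo (klink_nil hu) (klink_nil eus)).
have cW' x : x \in [set x in W] -> s x \in [set x in W] by rewrite !in_set; apply: cW.
have [||||y] := @escape _ _ esym s sP [set x in W] [set s u] (s u) cW'.
- by apply/subsetP=> x; rewrite !inE => /eqP->; rewrite eqxx orbT.
- by move=> y; rewrite !inE => /eqP->; rewrite ss eq_sym.
- by rewrite inE.
- by move=> y; rewrite inE => /eqP->; apply: central_s cu.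
have last x r : framed (x :: r) -> u \in x :: r -> framed [:: u].
  case=> vs' [f' n' sub'] ur; exists vs'; split=> // z; rewrite inE => /eqP->.
  exact: sub'.
rewrite inE => /eqP->{y} [[r [z [lr ur off cr [zW szY cz]]]]|[t [b [o [lt lb ut off [cr _]]]]]].
  have n1 : niceu (W ++ r).
    by apply: niceu_ear sP uW cW ur _ cr => x /off; rewrite in_set.
  have [zE|zN] := eqVneq z (s u).
    rewrite {}zE in lr.
    apply: last (lam_lollipop esym lam _ l1 lr) _; last by rewrite !inE eqxx orbT.
    by apply: niceu_perm n1; perm_count.
  have zv : z \in vs.
    move: zW szY; rewrite !inE (negPf zN) /=; case/orP=> // /eqP->.
    by rewrite eqxx.
  have n2 : niceu (vs ++ [:: u, s u & r]) by apply: niceu_perm n1; perm_count.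
  have l2 : ol h [:: u, s u & r] z := eo l1 lr.
  have [hz|hz] := eqVneq h z.
    rewrite -hz in l2; apply: last (lam_cycle esym lam n2 l2) _.
    by rewrite !inE eqxx orbT.
  by apply: framed1 (frame_ear esym fr n2 l2 hz hv zv).
apply: last (lam_lollipop esym lam (_ : niceu (vs ++ (u :: s u :: t) ++ b :: o)) _ lb) _.
- apply: niceu_perm (niceu_ear sP uW cW ut _ cr); first by perm_count.
  by move=> x /off; rewrite in_set.
- exact: ee l1 lt.
- by rewrite !inE eqxx orbT.
Qed.

(** * A first frame in a component [K] of central vertices *)

Section Existence.

Variable K : T -> Prop.
Hypothesis Kcentral : forall x, K x -> central x.
Hypothesis Kadj : forall x y, K x -> e x y -> central y -> K y.

Lemma path_K x p : K x -> path e x p -> (forall y, y \in p -> central y) ->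
  forall y, y \in p -> K y.
Proof.
elim: p x => //= z p IH x Kx /andP[xz zp] cp y.
have Kz : K z by apply: Kadj Kx xz _; apply: cp; rewrite mem_head.
rewrite inE => /predU1P[->//|]; apply: IH Kz zp _ y => w wp.
by apply: cp; rewrite inE wp orbT.
Qed.

Lemma klink_K k x p b : K x -> klink e k x p b ->
  (forall y, y \in p -> central y) -> forall y, y \in p -> K y.
Proof.
move=> Kx /andP[]; rewrite /link rcons_path => /andP[l _] _.
exact: path_K Kx l.
Qed.

Definition framedK := exists2 w, K w & framed [:: w].

(** On an even path of a theta these are the vertices from which [theta_lam] provides an odd path to
    an odd cycle. *)
Definition at_odd x1 x2 (a : seq T) y :=
  exists p q, [/\ a = p ++ y :: q, ol x1 p y & ol y q x2].

Lemma at_odd_size x1 x2 a y u v : uniq a -> at_odd x1 x2 a y -> a = u ++ y :: v ->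
  ~~ odd (size u).
Proof.
move=> ua [p [q [E lp _]]] E'.
have ix w t : a = w ++ y :: t -> index y a = size w.
  move=> Ew; move: ua; rewrite Ew cat_uniq /= => /and3P[_ + _].
  rewrite negb_or => /andP[yw _].
  by rewrite index_cat (negPf yw) /= eqxx addn0.
by rewrite -(ix _ _ E') (ix _ _ E); case/andP: lp => _ /eqP->.
Qed.

Lemma theta_sym x1 x2 a1 a2 c : theta x1 x2 a1 a2 c -> theta x1 x2 a2 a1 c.
Proof. by case=> h1 h2 h3; split. Qed.

Lemma at_odd_lam x1 x2 a1 a2 c y : theta x1 x2 a1 a2 c -> at_odd x1 x2 a1 y ->
  lam e (theta_seq x1 x2 a1 a2 c) y.
Proof. by move=> th [p [q [E lp lq]]]; rewrite E in th *; apply: theta_lam th lp lq. Qed.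

Definition theta_goal n := forall x1 x2 a1 a2 c, size c < n ->
  theta x1 x2 a1 a2 c -> niceu (theta_seq x1 x2 a1 a2 c) ->
  (forall x, x \in theta_seq x1 x2 a1 a2 c -> K x) -> framedK.

Lemma theta_ear x1 x2 a1 a2 c y r z : theta_goal (size c) ->
  theta x1 x2 a1 a2 c -> niceu (theta_seq x1 x2 a1 a2 c ++ r) ->
  (forall x, x \in theta_seq x1 x2 a1 a2 c -> K x) ->
  at_odd x1 x2 a1 y -> ol y r z -> (central z -> forall x, x \in r -> central x) ->
  [\/ z \in c, at_odd x1 x2 a1 z | at_odd x1 x2 a2 z] -> framedK.
Proof.
move=> IH th n Kth ya lr cz zP.
have Ky : K y.
  have [p [q [E _ _]]] := ya; apply: Kth; rewrite /theta_seq E.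
  by rewrite !(inE, mem_cat) eqxx !orbT.
have [yz|yz] := eqVneq y z.
  exists y => //; rewrite -yz in lr.
  exact: framed1 (lam_cycle esym (at_odd_lam th ya) n lr).
case: zP => zP.
- have [p [q [E lp lq]]] := ya; rewrite {}E in th n Kth.
  have [x1' [x2' [a1' [a2' [c' [th' n' lt sub]]]]]] :=
    theta_ear_shorten esym th n lp lq zP lr.
  apply: IH lt th' n' _ => x /sub; rewrite mem_cat => /orP[/Kth //|].
  apply: klink_K Ky lr _ x; apply/cz/Kcentral/Kth.
  by rewrite /theta_seq !(inE, mem_cat) zP !orbT.
- have [p [q [E lp lq]]] := ya; have [p' [q' [E' lp' lq']]] := zP.
  have yl : y \in a1 by rewrite E mem_cat mem_head orbT.
  have zl : z \in a1 by rewrite E' mem_cat mem_head orbT.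
  have n' : niceu (theta_seq x1 x2 a1 a2 c ++ rev r).
    by apply: niceu_perm n; rewrite perm_cat2l perm_sym perm_rev.
  have ua : uniq a1.
    by case: n; rewrite /theta_seq /= !cat_uniq => /and3P[_ _] /andP[/andP[]].
  (* Both ends have even index in [a1], so the segment between them has even length, as
     [theta_ear_same] requires. *)
  have main u m v g h r' : a1 = u ++ g :: m ++ h :: v -> at_odd x1 x2 a1 g ->
      at_odd x1 x2 a1 h -> niceu (theta_seq x1 x2 a1 a2 c ++ r') -> ol g r' h ->
      framed (g :: r').
    move=> Eg gP hP; rewrite {}Eg in ua th gP hP *; move=> N L.
    have su := at_odd_size ua gP erefl.
    have := at_odd_size ua hP (_ : _ = (u ++ g :: m) ++ h :: v).
    rewrite -catA size_cat /= oddD /= (negPf su) negbK => /(_ erefl) sm.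
    have [l1 _ _] := th; case/el_split: l1 => -[lu]; last first.
      by case/andP: lu => _; rewrite (negPf su).
    case/ol_split=> -[lm lv]; first by case/andP: lm; rewrite sm.
    exact: theta_ear_same th N lu lm lv L.
  have [p1 [m [s [E1|E1]]]] := mem_split2 yl zl yz.
    by exists y => //; exact: framed1 (main _ _ _ _ _ _ E1 ya zP n lr).
  exists z; last exact: framed1 (main _ _ _ _ _ _ E1 zP ya n' (olr esym lr)).
  by apply: Kth; rewrite /theta_seq !(inE, mem_cat) zl !orbT.
- exists y => //; have [p [q [E lp lq]]] := ya; have [p' [q' [E' lp' lq']]] := zP.
  rewrite {}E {}E' in th n.
  exact: framed1 (theta_ear_cross esym th n lp lq lp' lq' lr).
Qed.

Lemma theta_lollipop x1 x2 a1 a2 c y t b o :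
  theta x1 x2 a1 a2 c -> niceu (theta_seq x1 x2 a1 a2 c ++ t ++ b :: o) ->
  (forall x, x \in theta_seq x1 x2 a1 a2 c -> K x) ->
  at_odd x1 x2 a1 y -> el y t b -> ol b o b -> framedK.
Proof.
move=> th n Kth ya lt lb; exists y.
  have [p [q [E _ _]]] := ya; apply: Kth; rewrite /theta_seq E.
  by rewrite !(inE, mem_cat) eqxx !orbT.
exact: framed1 (lam_lollipop esym (at_odd_lam th ya) n lt lb).
Qed.

Lemma at_odd_snds x1 x2 a y : el x1 a x2 -> y \in snds (x1 :: a) -> at_odd x1 x2 a y.
Proof.
move=> la /snds_split[[|x p] [q []]] //= [_ E] op.
exists p, q; split=> //; rewrite E in la; case/el_split: la => -[lp lq] //;
  by case/andP: lp; rewrite (negPf op).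
Qed.

Lemma at_odd_fsts x1 x2 a y : el x1 a x2 -> y \in fsts (rcons a x2) -> at_odd x1 x2 a y.
Proof.
move=> la /fsts_split[p [q [E op]]].
case/lastP: q E => [|q z] E.
  have [Ea _] := rcons_inj (etrans E (cats1 p y)).
  by case/andP: la; rewrite Ea (negPf op).
move: E; rewrite -rcons_cons -rcons_cat => /rcons_inj[E _].
exists p, q; split=> //; rewrite E in la; case/el_split: la => -[lp lq] //;
  by case/andP: lp; rewrite (negPf op).
Qed.

(** Induction on the length of the odd path. Walks start from the set [Y] of vertices at odd
    distance from the ends of the even paths. The partners of [Y] are exactly the other vertices
    outside [c], so an ear ends on [c], which shortens the odd path, or again in [Y], which gives a
    frame. *)
Lemma theta_framedK n : theta_goal n.
Proof.
elim/ltn_ind: n => n IHn x1 x2 a1 a2 c cn th nth Kth.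
have {n cn IHn} IH : theta_goal (size c) := IHn _ cn.
have [l1 l2 l3] := th.
(* The chains fix the matching: [x1] goes with the first path, [x2] with the second, and [c] is
   matched within itself. *)
have ev : all evc [:: x1 :: a1; rcons a2 x2; c].
  by rewrite /= (evc_l l1) (evc_r l2) (evc_in l3).
have [|s [sP sl sW]] := niceu_total ev nth; first by perm_count.
have {}sl : [/\ paired s (x1 :: a1), paired s (rcons a2 x2) & paired s c].
  by split; apply: sl; rewrite !inE eqxx ?orbT.
have [s1 s2 s3] := sl.
set W := theta_seq x1 x2 a1 a2 c in nth Kth sW.
have mW x : (x \in W) = [|| x \in x1 :: a1, x \in rcons a2 x2 | x \in c].
  rewrite /W /theta_seq !(inE, mem_cat) mem_rcons inE.
  by case: (x == x1); case: (x == x2); rewrite ?orbT.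
have uW : uniq ((x1 :: a1) ++ rcons a2 x2 ++ c).
  by rewrite -(perm_uniq (_ : perm_eq W _)) ?nth.1 //; perm_count.
have [u1 /hasPn u12] : uniq (x1 :: a1) /\ ~~ has (mem (x1 :: a1)) (rcons a2 x2 ++ c).
  by move: uW; rewrite cat_uniq => /and3P[].
have u2 : uniq (rcons a2 x2) by move: uW; rewrite !cat_uniq => /and4P[_ _ ].
pose Y := [set y | (y \in snds (x1 :: a1)) || (y \in fsts (rcons a2 x2))].
have YP y : y \in Y -> at_odd x1 x2 a1 y \/ at_odd x1 x2 a2 y.
  rewrite inE => /orP[/at_odd_snds h|/at_odd_fsts h]; [left|right]; exact: h.
have sY y : y \in Y -> s y \notin Y.
  rewrite !inE negb_or => /orP[] yl.
    have [[yf _]|[_ sf]] := paired_fsts_snds s1 (mem_snds yl).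
      by have := fsts_snds u1 yf; rewrite yl.
    rewrite (fsts_snds u1 sf) /=; apply: contraL (mem_fsts sf) => /mem_fsts h.
    by apply: u12; rewrite mem_cat h.
  have [[_ sf]|[ys _]] := paired_fsts_snds s2 (mem_fsts yl); last first.
    by have := fsts_snds u2 yl; rewrite ys.
  apply/andP; split; last by apply: contraL sf => /(fsts_snds u2).
  by apply: contraL (mem_snds sf) => /mem_snds h; apply: contraL h => h; apply: u12; rewrite mem_cat h.
have zP z : z \in W -> s z \notin Y -> [\/ z \in c, at_odd x1 x2 a1 z | at_odd x1 x2 a2 z].
  rewrite mW !inE negb_or => /or3P[zl|zl|zc]; last by constructor 1.
    have [[_ ->] //|[zs _] _] := paired_fsts_snds s1 zl.
    by constructor 2; apply: at_odd_snds zs.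
  have [[zs _] _|[_ ->]] := paired_fsts_snds s2 zl; last by rewrite andbF.
  by constructor 3; apply: at_odd_fsts zs.
have sx1Y : s x1 \in Y.
  rewrite inE; apply/orP; left; move: s1; case: (a1) => [|y l] //= [-> _ _].
  exact: mem_head.
have cW' x : x \in [set x in W] -> s x \in [set x in W] by rewrite !in_set; apply: sW.
have YW : Y \subset [set x in W].
  by apply/subsetP=> x; rewrite !in_set mW =>
    /orP[/mem_snds|/mem_fsts]->; rewrite ?orbT.
have [|y yY] := @escape _ _ esym s sP [set x in W] Y (s x1) cW' YW sY sx1Y.
  by move=> y /(subsetP YW); rewrite in_set => /Kth/Kcentral.
have th' := theta_sym th.
have pW : perm_eq W (theta_seq x1 x2 a2 a1 c) by perm_count.
have Kth' x : x \in theta_seq x1 x2 a2 a1 c -> K x by rewrite -(perm_mem pW) => /Kth.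
case=> [[r [z [lr ur off cr [zW szY cz]]]]|[t [b [o [lt lb ut off [cr _]]]]]].
  have n1 : niceu (W ++ r).
    by apply: niceu_ear sP nth.1 sW ur _ cr => x /off; rewrite in_set.
  have {zW szY}zz : [\/ z \in c, at_odd x1 x2 a1 z | at_odd x1 x2 a2 z].
    by apply: zP szY; rewrite in_set in zW.
  have [ya|ya] := YP y yY; first exact: theta_ear IH th n1 Kth ya lr cz zz.
  apply: theta_ear IH th' _ Kth' ya lr cz _; last by case: zz; [constructor 1|constructor 3|constructor 2].
  by apply: niceu_perm n1; rewrite perm_cat2r.
have n1 : niceu (W ++ t ++ b :: o).
  by apply: niceu_ear sP nth.1 sW ut _ cr => x /off; rewrite in_set.
have [ya|ya] := YP y yY; first exact: theta_lollipop th n1 Kth ya lt lb.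
apply: theta_lollipop th' _ Kth' ya lt lb.
by apply: niceu_perm n1; rewrite perm_cat2r.
Qed.

(** The walk from [b'] returns to [b'] or ends in a lollipop, either of which makes a barbell, or it
    reaches [o]. In the last case the ear prolonged by [b b'] is an even path, and with the even and
    the odd arc of the cycle it forms a theta. *)
Lemma blossom_framedK b b' o : e b b' -> ol b o b -> niceu [:: b, b' & o] ->
  (forall x, x \in [:: b, b' & o] -> K x) -> framedK.
Proof.
move=> bb' lo n KW; set W := [:: b, b' & o] in n KW.
have lb := klink_nil bb'.
have ev : all evc [:: [:: b; b']; o] by rewrite /= (evc_in lo) /evc /= bb'.
have [|s [sP sl sW]] := niceu_total ev n; first by perm_count.
have [sb sb' _] : paired s [:: b; b'] by apply: sl; rewrite mem_head.
have cW' x : x \in [set x in W] -> s x \in [set x in W] by rewrite !in_set; apply: sW.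
have bNb' : b != b' by have := n.1; rewrite /= inE negb_or -andbA => /andP[].
have Kb' : K b' by apply: KW; rewrite !inE eqxx orbT.
have [||||y] := @escape _ _ esym s sP [set x in W] [set b'] b' cW'.
- by apply/subsetP=> x; rewrite !inE => /eqP->; rewrite eqxx orbT.
- by move=> y; rewrite !inE => /eqP->; rewrite sb'.
- by rewrite inE.
- by move=> y; rewrite inE => /eqP->; apply: Kcentral.
rewrite inE => /eqP->{y} [[r [z [lr ur off cr [zW szY cz]]]]|[t [b2 [o2 [lt l2 ut off [cr _]]]]]].
  have n1 : niceu (W ++ r).
    by apply: niceu_ear sP n.1 sW ur _ cr => x /off; rewrite in_set.
  move: zW; rewrite !inE => /or3P[/eqP E|/eqP E|zo].
  - by move: szY; rewrite E sb inE eqxx.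
  - exists b' => //; rewrite E in lr.
    apply: (framedI esym (FrameBarbell (And3 lo lb lr)) n1 (ls := [::])) => //.
      by perm_count.
    by move=> x; rewrite !(inE, mem_cat) => /eqP->; rewrite eqxx !orbT.
  have Kr x : x \in r -> K x.
    apply: klink_K Kb' lr _ x; apply/cz/Kcentral/KW; by rewrite !inE zo !orbT.
  have KWr x : x \in W ++ r -> K x by rewrite mem_cat => /orP[/KW|/Kr].
  have [p [q E]] := mem_split zo; rewrite E in lo.
  have la : el b (b' :: r) z := oo lb lr.
  case/ol_split: lo => -[lp lq].
    have th : theta b z (rev q) (b' :: r) p by split=> //; apply: elr.
    have pe : perm_eq (W ++ r) (theta_seq b z (rev q) (b' :: r) p).
      by rewrite /W E; perm_count.
    apply: theta_framedK (ltnSn _) th (niceu_perm pe n1) _.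
    by move=> x; rewrite -(perm_mem pe); apply: KWr.
  have th : theta b z p (b' :: r) (rev q) by split=> //; apply: olr.
  have pe : perm_eq (W ++ r) (theta_seq b z p (b' :: r) (rev q)).
    by rewrite /W E; perm_count.
  apply: theta_framedK (ltnSn _) th (niceu_perm pe n1) _.
  by move=> x; rewrite -(perm_mem pe); apply: KWr.
exists b' => //.
have n1 : niceu (W ++ t ++ b2 :: o2).
  by apply: niceu_ear sP n.1 sW ut _ cr => x /off; rewrite in_set.
apply: (framedI esym (FrameBarbell (And3 lo (oe lb lt) l2)) n1 (ls := [::])) => //.
  by perm_count.
by move=> x; rewrite !(inE, mem_cat) => /eqP->; rewrite eqxx !orbT.
Qed.

(** A walk from [v] gives an odd cycle with a matched edge at its base: either the ear closes at
    [v], with [v (s v)] as that edge, or the edge is the last one of the stem of a lollipop. *)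
Lemma framedK_exists s v : pmf s -> K v -> framedK.
Proof.
move=> sP Kv; have ss := pmfK sP; have svN := pmf_neq sP v; have evs := pmf_edge sP v.
pose W := [:: v; s v].
have sW x : x \in W -> s x \in W.
  by rewrite !inE => /orP[]/eqP->; rewrite ?ss eqxx ?orbT.
have cW' x : x \in [set x in W] -> s x \in [set x in W] by rewrite !in_set; apply: sW.
have uW : uniq W by rewrite /= inE eq_sym svN.
have Ksv : K (s v) by apply: (Kadj Kv evs); apply: (central_s sP); apply: Kcentral.
have [||||y] := @escape _ _ esym s sP [set x in W] [set v] v cW'.
- by apply/subsetP=> x; rewrite !inE => /eqP->; rewrite eqxx.
- by move=> y; rewrite !inE => /eqP->.
- by rewrite inE.
- by move=> y; rewrite inE => /eqP->; apply: Kcentral.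
rewrite inE => /eqP->{y} [[r [z [lr ur off cr [zW szY cz]]]]|[t [b [o [lt lo ut off [cr ct]]]]]].
  have n1 : niceu (W ++ r).
    by apply: niceu_ear sP uW sW ur _ cr => x /off; rewrite in_set.
  have E : z = v.
    move: zW szY; rewrite !inE => /orP[/eqP-> //|/eqP->].
    by rewrite ss eqxx.
  rewrite {}E in lr cz; apply: (blossom_framedK evs lr n1) => x.
  rewrite !inE => /or3P[/eqP->|/eqP->|xr] //.
  by apply: (klink_K Kv lr _ xr); apply/cz/Kcentral.
have n1 : niceu (W ++ t ++ b :: o).
  by apply: niceu_ear sP uW sW ut _ cr => x /off; rewrite in_set.
have Kt : forall x, x \in t -> K x.
  by apply: klink_K Kv lt _ => x xt; apply: ct; rewrite mem_cat xt.
case/lastP: t lt ut off cr ct n1 Kt => [|t b'] lt ut off cr ct n1 Kt.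
  by case/andP: lt.
have Kb' : K b' by apply: Kt; rewrite mem_rcons mem_head.
have [lt' eb] : ol v t b' /\ e b' b.
  move: lt; rewrite -cats1 => /el_split[[l1 /andP[]]|[_ /andP[]//]].
  by rewrite /link /= andbT.
have Kb : K b by apply: (Kadj Kb' eb); apply: ct; rewrite mem_cat mem_head orbT.
have Ko x : x \in o -> K x.
  by apply: klink_K Kb lo _ x => x xo; apply: ct; rewrite mem_cat inE xo !orbT.
have ev : all evc [:: W; t] by rewrite /= (evc_in lt') /evc /= evs.
(* Only the cycle and the end of its stem are kept; [v], its partner and the rest of the stem are
   even chains. *)
have pe : perm_eq (W ++ rcons t b' ++ b :: o) ([:: b, b' & o] ++ flatten [:: W; t]).
  by perm_count.
apply: (@blossom_framedK b b' o) lo _ _; first by rewrite esym.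
  split; last exact: nice_rm ev n1.1 n1.2 pe.
  by case: n1; rewrite (perm_uniq pe) cat_uniq => /and3P[].
by move=> x; rewrite !inE => /or3P[/eqP->|/eqP->|/Ko].
Qed.

End Existence.

Theorem central_framed s v : pmf s -> central v -> framed [:: v].
Proof.
move=> sP cv.
pose eJ a b := [&& e a b, `[< central a >] & `[< central b >]].
have eJsym : symmetric eJ by move=> a b; rewrite /eJ esym; congr (_ && _); rewrite andbC.
pose K w := central w /\ connect eJ v w.
have [||w [cw vw] fw] := @framedK_exists K _ _ s v sP (conj cv (connect0 _ _)).
- by move=> x [].
- move=> x y [cx vx] xy cy; split=> //; apply: (connect_trans vx); apply: connect1.
  by rewrite /eJ xy /=; apply/andP; split; apply/asboolP.
rewrite (sym_connect_sym eJsym) in vw; case/connectP: vw => p + ->.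
elim: p w fw {cw} => //= x p IH w fw /andP[/and3P[wx _ /asboolP cx]].
exact: IH (framed_adj fw wx cx).
Qed.

End Central.

(** * Matchings as sets of edges *)

Section Matchings.

Variable G : sgraph.
Implicit Types (M N : {set {set G}}) (x y z : G).

Lemma adj_neq x y : adj x y -> x != y.
Proof. by apply: contraTneq => ->; rewrite adj_irrefl. Qed.

Lemma set2_eq (a b x y : G) : a != b -> [set x; y] = [set a; b] ->
  (x = a /\ y = b) \/ (x = b /\ y = a).
Proof.
move=> ab E; have Em z : (z \in [set x; y]) = (z \in [set a; b]) by rewrite E.
have := Em a; have := Em b; have := Em x; have := Em y; rewrite !inE ?eqxx !orbT /=.
move=> /esym/orP[]/eqP yE /esym/orP[]/eqP xE; rewrite xE yE ?eqxx; try by [left|right].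
  by rewrite eq_sym (negPf ab).
by rewrite (negPf ab).
Qed.

Lemma edgesP f : reflect (exists x y, adj x y /\ f = [set x; y]) (f \in edges G).
Proof.
apply: (iffP imset2P) => [[x y _ xy ->]|[x [y [xy ->]]]]; first by exists x, y.
by exists x y; rewrite // inE.
Qed.

Lemma matching_adj M x y : matching M -> [set x; y] \in M -> adj x y.
Proof.
case/andP=> /subsetP sub _ /sub/edgesP[a [b [ab E]]].
have [[-> ->]|[-> ->]] := set2_eq (adj_neq ab) E; by rewrite // adj_sym.
Qed.

Lemma matching_inj M x y z : matching M -> [set x; y] \in M -> [set x; z] \in M -> y = z.
Proof.
move=> mM xy xz; have [_ tM] := andP mM.
have E : [set x; y] = [set x; z].
  apply/eqP/negPn/negP=> ne; have := trivIsetP tM _ _ xy xz ne.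
  by move/disjoint_setI0/setP/(_ x); rewrite !inE ?eqxx.
have [[_ ->] //|[_ yx]] := set2_eq (adj_neq (matching_adj mM xz)) E.
by move: (adj_neq (matching_adj mM xy)); rewrite yx eqxx.
Qed.

Lemma matching_card M : matching M -> #|cover M| = #|M| * 2.
Proof.
move=> mM; have [/subsetP sub tM] := andP mM.
apply: card_uniform_partition.
  by move=> f /sub/edgesP[x [y [xy ->]]]; rewrite cards2 (adj_neq xy).
apply/and3P; split=> //; apply/negP=> /sub/edgesP[x [y [_ E]]].
have : x \in [set x; y] by rewrite !inE eqxx.
by rewrite -E inE.
Qed.

Lemma saturatedP M x : matching M -> reflect (exists y, [set x; y] \in M) (saturated M x).
Proof.
move=> mM; have [/subsetP sub tM] := andP mM.
apply: (iffP bigcupP) => [[f fM xf]|[y xyM]]; last by exists [set x; y]; rewrite ?inE ?eqxx.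
have [a [b [ab E]]] := edgesP _ (sub _ fM); rewrite {}E !inE in fM xf.
by case/orP: xf => /eqP->; [exists b | exists a; rewrite setUC].
Qed.

Definition mate M x := odflt x [pick y | [set x; y] \in M].

Lemma mateE M x y : matching M -> [set x; y] \in M -> mate M x = y.
Proof.
move=> mM xy; rewrite /mate; case: pickP => [z xz|/(_ y)]; last by rewrite xy.
exact: matching_inj mM xz xy.
Qed.

Lemma mateP M x : matching M -> saturated M x -> [set x; mate M x] \in M.
Proof. by move=> mM /(saturatedP _ mM)[y xy]; rewrite (mateE mM xy). Qed.

Lemma pm_matching (A : {set G}) t : pmf (@adj G) A t ->
  let N := [set [set x; t x] | x in A] in
  [/\ matching N, cover N = A &
      forall x y, ([set x; y] \in N) = (x \in A) && (t x == y)].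
Proof.
move=> tP N.
have NE x y : ([set x; y] \in N) = (x \in A) && (t x == y).
  apply/imsetP/andP=> [[z zA E]|[xA /eqP<-]]; last by exists x.
  have [tzA tK tn ad] := tP _ zA.
  have [[-> ->]|[-> ->]] := set2_eq (adj_neq ad) E; first by rewrite zA eqxx.
  by rewrite tzA tK eqxx.
split=> //.
  apply/andP; split.
    apply/subsetP=> _ /imsetP[x /tP[_ _ _ ad] ->]; apply/edgesP.
    by exists x, (t x).
  apply/trivIsetP=> _ _ /imsetP[x xA ->] /imsetP[y yA ->] ne.
  rewrite -setI_eq0; apply/eqP/setP=> z; rewrite !inE; apply/negP=> /andP[zx zy].
  have [_ tKx _ _] := tP _ xA; have [_ tKy _ _] := tP _ yA.
  move/eqP: ne; apply; move: zx zy => /orP[]/eqP-> /orP[]/eqP E.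
  - by rewrite E.
  - by rewrite E tKy setUC.
  - by rewrite -E tKx setUC.
  - by rewrite -tKx E tKy.
apply/setP=> x; apply/bigcupP/idP=> [[_ /imsetP[y yA ->]]|xA].
  by rewrite !inE => /orP[]/eqP-> //; have [] := tP _ yA.
by exists [set x; t x]; rewrite ?inE ?eqxx //; apply/imsetP; exists x.
Qed.

Fixpoint mpaired N (l : seq G) : bool :=
  match l with
  | x :: y :: l' => ([set x; y] \in N) && mpaired N l'
  | x :: nil => false
  | nil => true
  end.

Lemma mpaired_cat N l1 l2 : mpaired N l1 -> mpaired N (l1 ++ l2) = mpaired N l2.
Proof.
by elim/seq_pair_ind: l1 => //= x y l IH /andP[-> /IH].
Qed.

Lemma mpaired_rev N l : mpaired N l -> mpaired N (rev l).
Proof.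
elim/seq_pair_ind: l => //= x y l IH /andP[xy /IH h].
by rewrite !rev_cons -!cats1 -catA mpaired_cat //= setUC xy.
Qed.

Fixpoint pairs_of (l : seq G) : seq {set G} :=
  if l is x :: y :: l' then [set x; y] :: pairs_of l' else [::].

Lemma pairs_ofP l f : f \in pairs_of l ->
  exists p x y q, l = p ++ x :: y :: q /\ f = [set x; y].
Proof.
elim/seq_pair_ind: l => //= x y l IH; rewrite inE => /predU1P[->|/IH].
  by exists [::], x, y, l.
by case=> p [a [b [q [-> ->]]]]; exists [:: x, y & p], a, b, q.
Qed.

Lemma uniq_pairs_of l : uniq l -> uniq (pairs_of l).
Proof.
elim/seq_pair_ind: l => //= x y l IH /and3P[xl yl /IH->]; rewrite andbT.
apply/negP=> /pairs_ofP[p [a [b [q [E F]]]]].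
have h : x \in [set a; b] by rewrite -F !inE ?eqxx.
rewrite !inE in h.
move: xl; rewrite inE negb_or E mem_cat !inE => /andP[_].
by case/orP: h => ->; rewrite ?orbT.
Qed.

Lemma mpaired_mem N l x : mpaired N l -> x \in l ->
  exists y, [/\ y \in l, [set x; y] \in N & [set x; y] \in pairs_of l].
Proof.
elim/seq_pair_ind: l => //= a b l IH /andP[ab /IH h].
rewrite !inE => /or3P[/eqP->|/eqP->|/h[y [yl xyN xyl]]].
- by exists b; rewrite !inE ?eqxx ?orbT.
- by exists a; rewrite !inE setUC !eqxx.
- by exists y; rewrite !inE yl xyl !orbT.
Qed.

Lemma mpaired_pairs N l f : mpaired N l -> f \in pairs_of l -> f \in N.
Proof.
elim/seq_pair_ind: l => //= a b l IH /andP[ab /IH h].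
by rewrite inE => /predU1P[->|/h].
Qed.

Lemma size_pairs_of N l : mpaired N l -> size (pairs_of l) = (size l)./2.
Proof. by elim/seq_pair_ind: l => //= a b l IH /andP[_ /IH->]. Qed.

Lemma next_mid (c : seq G) p x y q : uniq c -> c = p ++ x :: y :: q -> next c x = y.
Proof.
move=> uc E; rewrite next_nth.
have -> : x \in c by rewrite E mem_cat mem_head orbT.
have ix : index x c = size p.
  move: uc; rewrite E cat_uniq /= => /and3P[_ /norP[xp _] _].
  by rewrite index_cat (negPf xp) /= eqxx addn0.
rewrite ix; case: p E {ix} => [|a p] -> //=.
by rewrite nth_cat ltnNge leqnSn /= subSnn.
Qed.

(** Each vertex of [o] has its partner beside it in [o] and none is matched to [b], so the matching
    edges of the cycle are exactly the consecutive pairs of [o]. *)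
Lemma blossomI N b o : matching N -> klink (@adj G) false b o b -> uniq (b :: o) ->
  mpaired N o -> (forall x, x \in o -> [set b; x] \notin N) ->
  blossom N (b :: o) /\ blossom_base N (b :: o) b.
Proof.
move=> mN /andP[lo /eqP so] u mo nb.
have E : cycle_edges (b :: o) :&: N = [set f in pairs_of o].
  apply/setP=> f; rewrite !inE; apply/andP/idP=> [[/imsetP[x xc ->] fN]|fo].
    have nN : next (b :: o) x \in b :: o by rewrite mem_next.
    move: xc; rewrite inE => /predU1P[xb|xo].
      move: nN fN; rewrite xb inE => /predU1P[->|/nb/negPf->] //.
      by move/(matching_adj mN); rewrite adj_irrefl.
    have [y [_ xyN xyo]] := mpaired_mem mo xo.
    by rewrite -(matching_inj mN xyN fN).
  split; last exact: mpaired_pairs mo fo.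
  have [p [x [y [q [E ->]]]]] := pairs_ofP fo.
  apply/imsetP; exists x; first by rewrite E inE mem_cat mem_head !orbT.
  by rewrite (@next_mid _ (b :: p) x y q u) // E.
have on : 1 < size o.
  case: (o) lo so => [|z [|? ?]] //=; by rewrite /link /= adj_irrefl.
split.
  apply/and5P; split=> //; first by rewrite /= so.
  rewrite E cardsE (card_uniqP (uniq_pairs_of _)); last by case/andP: u.
  by rewrite (size_pairs_of mo) /= uphalf_half so.
rewrite /blossom_base mem_head E /=; apply/negP=> /bigcupP[f].
rewrite inE => /pairs_ofP[p [x [y [q [Eo ->]]]]].
have /andP[bo _] := u.
by rewrite !inE => /orP[]/eqP bE; move: bo; rewrite Eo bE mem_cat !inE ?eqxx ?orbT.
Qed.

Definition alt N := fun f g : {set G} => (f \in N) (+) (g \in N).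

(** Every second edge is a pair of [N]; an edge between two pairs is not in [N], since its end is
    already matched to another vertex. *)
Lemma alt_mpaired N x p : matching N -> mpaired N (x :: p) -> uniq (x :: p) ->
  sorted (alt N) (walk_edges x p) /\ mm_ends N (walk_edges x p).
Proof.
move=> mN; suff : forall l, mpaired N l -> uniq l -> forall x p, l = x :: p ->
    sorted (alt N) (walk_edges x p) /\ mm_ends N (walk_edges x p).
  by move=> h m u; apply: h m u _ _ erefl.
elim/seq_pair_ind=> //= a b l IH /andP[ab ml] /and3P[al bl ul] {}x {}p [<- <-] /=.
case: l IH ml al bl ul => [|c [|d l]] //= IH; first by rewrite ab.
move=> ml al bl ul; have [h1 h2] := IH ml ul _ _ erefl.
have cd : [set c; d] \in N by case/andP: ml.
have bc : [set b; c] \notin N.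
  apply/negP=> bc; move: ab; rewrite setUC => ba.
  by move: al; rewrite (matching_inj mN ba bc) !inE ?eqxx orbT.
rewrite /alt /= ab (negPf bc) cd /=; split; first exact: h1.
by case/andP: h2.
Qed.

Lemma alt_mpaired_rcons N x p z : matching N -> mpaired N (x :: p) ->
  uniq (x :: rcons p z) -> sorted (alt N) (walk_edges x (rcons p z)).
Proof.
move=> mN; suff : forall l, mpaired N l -> forall x p, l = x :: p ->
    uniq (x :: rcons p z) -> sorted (alt N) (walk_edges x (rcons p z)).
  by move=> h m; apply: h m _ _ erefl.
elim/seq_pair_ind=> //= a b l IH /andP[ab ml] {}x {}p [<- <-] /=.
have bN c : a != c -> [set b; c] \notin N.
  move=> ac; apply/negP=> bc; move: ab; rewrite setUC => ba.
  by move: ac; rewrite (matching_inj mN ba bc) eqxx.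
case: l IH ml => [|c [|d l]] //= IH ml.
  by rewrite /alt !inE !negb_or ab => /andP[/andP[_ /bN/negPf->]].
move=> /and3P[al bl ul]; have h := IH ml _ _ erefl ul.
have cd : [set c; d] \in N by case/andP: ml.
have bc : [set b; c] \notin N.
  by apply: bN; apply: contraNneq al => ->; rewrite !inE ?eqxx orbT.
by rewrite /alt /= ab (negPf bc) cd.
Qed.

Lemma walk_edges_mid x p f : f \in walk_edges x p ->
  exists u y z w, x :: p = u ++ y :: z :: w /\ f = [set y; z].
Proof.
elim: p x => //= y p IH x; rewrite inE => /predU1P[->|/IH].
  by exists [::], x, y, p.
by case=> u [a [b [w [-> ->]]]]; exists (x :: u), a, b, w.
Qed.

Lemma mid_walk_edges x p u y z w : x :: p = u ++ y :: z :: w ->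
  [set y; z] \in walk_edges x p.
Proof.
elim: u x p => [|a u IH] x p /=; first by case=> -> ->; rewrite /= mem_head.
case: p => [|b p] [_ E]; first by case: u E {IH}.
by rewrite /= inE (IH _ _ E) orbT.
Qed.

Lemma mm_pathI N x p z : matching N -> link (@adj G) x p z ->
  mpaired N (x :: rcons p z) -> uniq (x :: rcons p z) -> mm_path N x (rcons p z).
Proof.
move=> mN l m u; have [h1 h2] := alt_mpaired mN m u.
by rewrite /mm_path /mm_walk /alt_walk u h2 !andbT; apply/andP.
Qed.

Lemma barbell_Tposy N b1 o1 q b2 o2 : matching N ->
  barbell (@adj G) b1 o1 q b2 o2 -> uniq (barbell_seq b1 o1 q b2 o2) ->
  mpaired N o1 -> mpaired N o2 -> mpaired N (b1 :: rcons q b2) ->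
  Tposy N (b1 :: o1) (b2 :: o2) b1 q b2.
Proof.
move=> mN [l1 l2 l3] u m1 m2 mq.
have u' : uniq ((b1 :: rcons q b2) ++ o1 ++ o2).
  by rewrite -(perm_uniq (_ : perm_eq (barbell_seq b1 o1 q b2 o2) _)) //; perm_count.
have [uq /hasPn nq uo] := and3P (eq_ind _ is_true u' _ (cat_uniq _ _)).
have path_out x y : x \in b1 :: rcons q b2 -> y \in o1 ++ o2 -> [set x; y] \notin N.
  move=> xq yo; apply/negP=> xy; have [z [zq xz _]] := mpaired_mem mq xq.
  by have := nq _ yo; rewrite /= -(matching_inj mN xz xy) zq.
have ub b o : {subset o <= o1 ++ o2} -> uniq o -> b \in b1 :: rcons q b2 -> uniq (b :: o).
  move=> sub uo' bq; rewrite /= uo' andbT; apply/negP=> /sub/nq.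
  by rewrite /= bq.
have s1 : {subset o1 <= o1 ++ o2} by move=> x; rewrite mem_cat => ->.
have s2 : {subset o2 <= o1 ++ o2} by move=> x; rewrite mem_cat => ->; rewrite orbT.
have [uo1 _ uo2] := and3P (eq_ind _ is_true uo _ (cat_uniq _ _)).
have i1 : b1 \in b1 :: rcons q b2 by rewrite mem_head.
have i2 : b2 \in b1 :: rcons q b2 by rewrite inE mem_rcons mem_head orbT.
split.
- by apply: blossomI => //; [exact: ub s1 uo1 i1 | move=> x /s1; apply: path_out].
- by apply: blossomI => //; [exact: ub s2 uo2 i2 | move=> x /s2; apply: path_out].
- by apply: mm_pathI => //; case/andP: l2.
- move=> x xq; have xq' : x \in b1 :: rcons q b2 by rewrite !inE mem_rcons inE xq !orbT.
  have xo : x \notin o1 ++ o2 by apply/negP=> /nq; rewrite /= xq'.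
  move: xo; rewrite mem_cat negb_or => /andP[xo1 xo2].
  move: uq; rewrite /= mem_rcons inE negb_or rcons_uniq -andbA => /and4P[b12 b1q b2q _].
  rewrite !inE !negb_or xo1 xo2 !andbT.
  by split; apply/eqP=> E; [move: b1q | move: b2q]; rewrite -E xq.
- left; apply/setP=> x; rewrite in_set0 in_setI !in_set; apply/negP=> /andP[x1 x2].
  move: u; rewrite /barbell_seq -cat_cons cat_uniq => /and3P[_ /hasPn h _].
  by have := h x; rewrite mem_cat x2 orbT /= x1 => /(_ isT).
Qed.

End Matchings.

(** * Flowers, and posies from a subdivided K4 *)

Section Posies.

Variable G : sgraph.
Implicit Types (M N : {set {set G}}) (x y z : G).

Lemma mpaired_even N l : mpaired N l -> ~~ odd (size l).
Proof. by elim/seq_pair_ind: l => //= x y l IH /andP[_ /IH]; rewrite negbK. Qed.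

Lemma next_last x0 (l : seq G) : uniq (x0 :: l) -> next (x0 :: l) (last x0 l) = x0.
Proof.
by move=> u; rewrite next_nth mem_last index_last // nth_default.
Qed.

Lemma blossom_Tflower N b o : matching N -> klink (@adj G) false b o b ->
  uniq (b :: o) -> mpaired N o -> ~~ saturated N b -> Tflower N (b :: o) b [::].
Proof.
move=> mN lo u mo sb.
have nb x : x \in o -> [set b; x] \notin N.
  by move=> _; apply: contra sb => h; apply/(saturatedP _ mN); exists x.
split=> //; first exact: blossomI.
by apply/setP=> x; rewrite !inE; case: (x == b); rewrite ?andbF.
Qed.

Lemma stem_Tflower N b o p z : matching N -> klink (@adj G) false b o b ->
  link (@adj G) b p z -> uniq (b :: o ++ rcons p z) -> mpaired N o ->
  mpaired N (b :: p) -> ~~ saturated N z -> Tflower N (b :: o) b (rcons p z).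
Proof.
move=> mN lo lp u mo mp sz; have /andP[bo u'] := u.
have [uo /hasPn no up] := and3P (eq_ind _ is_true u' _ (cat_uniq _ _)).
move: bo; rewrite mem_cat negb_or => /andP[bo bp].
have nb x : x \in o -> [set b; x] \notin N.
  move=> xo; apply/negP=> bx; have [y [yp by_ _]] := mpaired_mem mp (mem_head _ _).
  move: yp; rewrite (matching_inj mN by_ bx) inE => /predU1P[E|xp].
    by rewrite E (negPf bo) in xo.
  by have := no x; rewrite mem_rcons inE xp orbT /= xo => /(_ isT).
have ubp : uniq (b :: rcons p z) by rewrite /= bp.
split=> //.
- by apply: blossomI => //=; rewrite bo.
- rewrite /alt_path /alt_walk ubp andbT; apply/andP; split=> //.
  exact: alt_mpaired_rcons.
- by have := mpaired_even mp; rewrite size_rcons.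
- by rewrite last_rcons.
- apply/setP=> x; rewrite !inE; have [->|xb] := eqVneq x b => //=.
  by apply/negP=> /andP[xo /no]; rewrite /= xo.
Qed.

(** The blossoms are the triangles on [a], [c], [d] and on [b], [c], [d]. They share the path from
    [c] to [d], whose ends are matched inside it, and [ab] joins their bases. *)
Lemma k4_Tposy N a b c d ab ac ad bc bd cd : matching N ->
  k4 (@adj G) a b c d ab ac ad bc bd cd -> uniq (k4_seq a b c d ab ac ad bc bd cd) ->
  mpaired N (a :: rcons ab b) -> mpaired N (c :: rcons cd d) ->
  mpaired N ac -> mpaired N ad -> mpaired N bc -> mpaired N bd ->
  Tposy N (a :: ac ++ c :: cd ++ d :: rev ad) (b :: bc ++ c :: cd ++ d :: rev bd)
    a ab b.
Proof.
move=> mN [[l1 l2 l3] [l4 l5 l6]] u mab mcd mac mad mbc mbd.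
set o1 := ac ++ _; set o2 := bc ++ _.
pose P := a :: rcons ab b; pose S := c :: rcons cd d.
have asym := @adj_sym G.
have uA : uniq (P ++ S ++ ac ++ ad ++ bc ++ bd).
  by rewrite -(perm_uniq (_ : perm_eq (k4_seq a b c d ab ac ad bc bd cd) _)) // /P /S; perm_count.
have o1E : perm_eq o1 (S ++ ac ++ ad) by rewrite /o1 /S; perm_count.
have o2E : perm_eq o2 (S ++ bc ++ bd) by rewrite /o2 /S; perm_count.
have uP1 : uniq (P ++ o1).
  have : uniq ((P ++ o1) ++ bc ++ bd).
    by rewrite -(perm_uniq (_ : perm_eq (P ++ S ++ ac ++ ad ++ bc ++ bd) _)) //;
      perm_count_with o1E.
  by rewrite cat_uniq => /andP[].
have uP2 : uniq (P ++ o2).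
  have : uniq ((P ++ o2) ++ ac ++ ad).
    by rewrite -(perm_uniq (_ : perm_eq (P ++ S ++ ac ++ ad ++ bc ++ bd) _)) //;
      perm_count_with o2E.
  by rewrite cat_uniq => /andP[].
have aP : a \in P by rewrite mem_head.
have bP : b \in P by rewrite inE mem_rcons mem_head orbT.
have out o x : uniq (P ++ o) -> x \in P -> x \notin o.
  by rewrite cat_uniq => /and3P[_ /hasPn h _] xP; apply/negP=> /h; rewrite /= xP.
have nN o x y : uniq (P ++ o) -> x \in P -> y \in o -> [set x; y] \notin N.
  move=> uo xP yo; apply/negP=> xy; have [z [zP xz _]] := mpaired_mem mab xP.
  by move: (out _ _ uo zP); rewrite (matching_inj mN xz xy) yo.
have uo1 : uniq (a :: o1).
  by rewrite /= (out _ _ uP1 aP); move: uP1; rewrite cat_uniq => /and3P[].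
have uo2 : uniq (b :: o2).
  by rewrite /= (out _ _ uP2 bP); move: uP2; rewrite cat_uniq => /and3P[].
have mo (p q : seq G) : mpaired N p -> mpaired N q ->
    mpaired N (p ++ c :: cd ++ d :: rev q).
  move=> mp mq; rewrite mpaired_cat // -cat_rcons -cat_cons mpaired_cat //.
  exact: mpaired_rev.
have meet x : (x \in a :: o1) && (x \in b :: o2) = (x \in S).
  rewrite [x \in a :: o1]in_cons [x \in b :: o2]in_cons (perm_mem o1E) (perm_mem o2E).
  rewrite !mem_cat.
  case xS: (x \in S); first by rewrite /= !orbT.
  have : uniq ((a :: ac ++ ad) ++ (b :: bc ++ bd) ++ ab ++ S).
    rewrite -(perm_uniq (_ : perm_eq (k4_seq a b c d ab ac ad bc bd cd) _)) //.
    by rewrite /S; perm_count.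
  rewrite cat_uniq => /and3P[_ /hasPn h _]; apply/negbTE/negP=> /andP[/= x1 x2].
  have xa : x \in a :: ac ++ ad by rewrite in_cons mem_cat.
  have /h : x \in (b :: bc ++ bd) ++ ab ++ S by rewrite mem_cat in_cons mem_cat x2.
  by rewrite /= xa.
split.
- apply: blossomI => //; [exact: oe l2 (oo l6 (olr asym l3)) | exact: mo |].
  by move=> x; apply: nN.
- apply: blossomI => //; [exact: oe l4 (oo l6 (olr asym l5)) | exact: mo |].
  by move=> x; apply: nN.
- apply: mm_pathI => //; first by case/andP: l1.
  by move: uA; rewrite cat_uniq => /andP[].
- move=> x xab; have xP : x \in P by rewrite !inE mem_rcons inE xab !orbT.
  have : uniq P by move: uA; rewrite cat_uniq => /andP[].
  rewrite /= mem_rcons inE negb_or rcons_uniq => /and3P[/andP[_ aab] bab _].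
  rewrite !inE !negb_or (out _ _ uP1 xP) (out _ _ uP2 xP) !andbT.
  by split; apply/eqP=> E; [move: aab | move: bab]; rewrite -E xab.
- right; exists c, (rcons cd d).
  have uS : uniq S by move: uA; rewrite cat_uniq => /and3P[_ _]; rewrite cat_uniq => /andP[].
  split.
  + by apply: mm_pathI => //; case/andP: l6.
  + by apply/setP=> x; rewrite in_setI !in_set meet.
  have mid o p q : o = p ++ S ++ q -> forall x y u w, S = u ++ x :: y :: w ->
      o = (p ++ u) ++ x :: y :: w ++ q.
    by move=> -> x y u' w ->; rewrite -!catA.
  have E1 : a :: o1 = (a :: ac) ++ S ++ rev ad by rewrite /o1 /S /= cat_rcons.
  have E2 : b :: o2 = (b :: bc) ++ S ++ rev bd by rewrite /o2 /S /= cat_rcons.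
  have nx o p q x y u' w : uniq o -> o = p ++ S ++ q -> S = u' ++ x :: y :: w ->
      next o x = y.
    by move=> uo oE SE; apply: next_mid uo (mid _ _ _ oE _ _ _ _ SE).
  apply/setP=> f; rewrite in_setI in_set; apply/andP/idP=> [[f1 f2]|fS].
    have inc (o : seq G) x g : g \in cycle_edges o -> x \in g -> x \in o.
      by case/imsetP=> z zo ->; rewrite !inE => /orP[]/eqP->; rewrite ?mem_next.
    have fS x : x \in f -> x \in S by move=> xf; rewrite -meet (inc _ _ _ f1) ?(inc _ _ _ f2).
    case/imsetP: f1 => x x1 fE; have xS : x \in S by apply: fS; rewrite fE !inE eqxx.
    have nS : next (a :: o1) x \in S by apply: fS; rewrite fE !inE eqxx orbT.
    have [p [[|y q] SE]] := mem_split xS; last first.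
      by rewrite fE (nx _ _ _ _ _ _ _ uo1 E1 SE); apply: mid_walk_edges SE.
    have xd : x = d by move: SE; rewrite cats1 /S -rcons_cons => /rcons_inj[].
    (* The successor of [d] on the first cycle lies on [ad] or is [a], hence off [S], so no common
       edge starts at [d]. *)
    have : next (a :: o1) x \in rcons (rev ad) a.
      case adE: (rev ad) => [|y r].
        have -> : x = last a o1 by rewrite xd /o1 adE !(last_cat, last_cons).
        by rewrite next_last // mem_head.
      have -> : next (a :: o1) x = y.
        by apply: (@next_mid _ _ (a :: ac ++ c :: cd) _ _ r uo1); rewrite xd /o1 adE /= -catA.
      by rewrite mem_head.
    rewrite mem_rcons in_cons mem_rev => /orP[/eqP E|h].
      by move: (out _ _ uP1 aP); rewrite -E (perm_mem o1E) mem_cat nS.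
    have : uniq (S ++ ac ++ ad) by rewrite -(perm_uniq o1E); case/andP: uo1.
    rewrite cat_uniq => /and3P[_ /hasPn /(_ (next (a :: o1) x)) no _].
    by move: no; rewrite mem_cat h orbT /= nS => /(_ isT).
  have [p [x [y [q [SE ->]]]]] := walk_edges_mid fS.
  have xS : x \in S by rewrite /S SE mem_cat mem_head orbT.
  move: xS; rewrite -meet => /andP[x1 x2].
  split; apply/imsetP; exists x => //.
    by rewrite (nx _ _ _ _ _ _ _ uo1 E1 SE).
  by rewrite (nx _ _ _ _ _ _ _ uo2 E2 SE).
Qed.

End Posies.

(** * From walks to covers *)

Section Weights.

Variables (G : sgraph) (M : {set {set G}}) (g : G -> nat).
Hypothesis mM : matching M.
Hypothesis g_adj : forall x y, adj x y -> 2 <= g x + g y.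
Hypothesis g_M : forall x y, [set x; y] \in M -> g x + g y = 2.
Hypothesis g_free : forall x, ~~ saturated M x -> g x <= 1.

(** The inequality at one end of an edge that, together with the same one at the other end, forces
    weight 1 at both. *)
Definition tight_at x (f : {set G}) := if f \in M then 1 <= g x else g x <= 1.

(** Crossing an edge reverses the inequality, and alternation then makes it the tight one for the
    next edge. At the last edge it meets the opposite requirement, and equality travels back to
    [x]. *)
Lemma alt_walk_ones x y p : alt_walk M x (y :: p) -> tight_at x [set x; y] ->
  tight_at (last y p) (last [set x; y] (walk_edges y p)) ->
  forall z, z \in [:: x, y & p] -> g z = 1.
Proof.
rewrite /alt_walk /tight_at => /andP[].
elim: p x y => [|z p IH] x y /=.
  move=> /andP[xy _] _; have := g_adj xy; have := @g_M x y.
  case: ifP => _ h1 h2 h3 h4 z; rewrite !inE => /orP[]/eqP->;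
    move: h1 h2 h3 h4; clear; lia.
move=> /andP[xy yzp] /andP[xyz al] hx hl.
have yz : adj y z by case/andP: yzp.
have hy : if [set y; z] \in M then 1 <= g y else g y <= 1.
  move: xyz hx (g_adj xy) (@g_M x y); case: ifP; case: ifP => //= _ _ _;
  clear; lia.
have h := IH y z yzp al hy hl; have gy : g y = 1 by apply: h; rewrite mem_head.
have gx : g x = 1.
  move: hx gy (g_adj xy) (@g_M x y); case: ifP => _; clear; lia.
by move=> w; rewrite inE => /predU1P[->//|/h].
Qed.

Lemma sum_next (c : seq G) (f : G -> nat) : uniq c ->
  \sum_(x <- c) f (next c x) = \sum_(x <- c) f x.
Proof.
move=> uc; rewrite -(big_map (next c) xpredT f); apply: perm_big.
apply: uniq_perm => //.
  by rewrite map_inj_in_uniq // => x y _ _; apply: (can_inj (prev_next uc)).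
move=> x; apply/mapP/idP=> [[y yc ->]|xc]; first by rewrite mem_next.
by exists (prev c x); rewrite ?mem_prev // next_prev.
Qed.

(** By counting, the matching edges of the cycle cover everything except [b], and each contributes
    weight 2. *)
Lemma blossom_sum c b : blossom M c -> blossom_base M c b ->
  \sum_(x <- c) g x = g b + (size c).-1.
Proof.
case/and5P=> _ uc c2 oc /eqP nM /andP[bc bN].
set N := cycle_edges c :&: M in nM bN.
have mN : matching N.
  have [/subsetP sub tM] := andP mM; apply/andP; split.
    by apply/subsetP=> f; rewrite inE => /andP[_ /sub].
  by apply: trivIsetS tM; apply: subsetIr.
have cN := matching_card mN; rewrite nM in cN.
have Nc : cover N \subset [set x in c] :\ b.
  apply/subsetP=> x xN; rewrite !inE; apply/andP; split.
    by apply: contraNneq bN => <-.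
  case/bigcupP: xN => f; rewrite inE => /andP[/imsetP[y yc ->] _].
  by rewrite !inE => /orP[]/eqP->; rewrite ?mem_next.
have cc : #|[set x in c]| = size c by rewrite cardsE (card_uniqP uc).
have cb : #|[set x in c] :\ b| = (size c).-1.
  by have := cardsD1 b [set x in c]; rewrite inE bc cc => ->.
have s2 : (size c)./2 * 2 = (size c).-1.
  by rewrite -[in RHS](odd_double_half (size c)) oc muln2.
have {Nc cb}Nc : cover N = [set x in c] :\ b.
  by apply/eqP; rewrite eqEcard Nc cb cN s2 leqnn.
have -> : \sum_(x <- c) g x = \sum_(x in [set x in c]) g x.
  by rewrite big_uniq //; apply: eq_bigl => x; rewrite inE.
rewrite (big_setD1 b) ?inE //= -Nc; congr (_ + _).
have [_ tN] := andP mN; rewrite big_trivIset //=.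
transitivity (\sum_(f in N) 2); last by rewrite sum_nat_const nM s2.
have [/subsetP sub _] := andP mN.
apply: eq_bigr => f fN; have [x [y [xy fE]]] := edgesP _ (sub _ fN).
rewrite fE big_setU1 ?big_set1 ?inE ?adj_neq //= g_M //.
by move: fN; rewrite fE inE => /andP[].
Qed.

Lemma blossom_adj c x : blossom M c -> x \in c -> adj x (next c x).
Proof. by case/and5P=> cy uc _ _ _; apply: next_cycle. Qed.

(** Adding the cover inequality over all edges of the cycle bounds its weight from below by its
    length; [blossom_sum] does the rest. *)
Lemma blossom_base_ge1 c b : blossom M c -> blossom_base M c b -> 1 <= g b.
Proof.
move=> bl bb; have := blossom_sum bl bb; have /and5P[_ uc c2 _ _] := bl.
have : \sum_(x <- c) 2 <= \sum_(x <- c) (g x + g (next c x)).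
  by rewrite !big_seq; apply: leq_sum => x /(blossom_adj bl)/g_adj.
rewrite big_split /= (sum_next g uc) big_const_seq count_predT iter_addn_0.
move: c2; clear; lia.
Qed.

(** Now the weight equals the length, so every cover inequality on the cycle is an equality and the
    value 1 spreads from [b]. *)
Lemma blossom_ones c b : blossom M c -> blossom_base M c b -> g b = 1 ->
  forall x, x \in c -> g x = 1.
Proof.
move=> bl bb gb; have := blossom_sum bl bb; have /and5P[_ uc c2 _ _] := bl.
rewrite gb add1n prednK; last by apply: leq_trans c2.
move=> sc.
have pairE x : x \in c -> g x + g (next c x) = 2.
  move=> xc; have le y : y \in [set y in c] ->
      2 <= g y + g (next c y) ?= iff (2 == g y + g (next c y)).
    by rewrite inE => yc; apply/leqif_eq/g_adj/blossom_adj.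
  have /leqifP := leqif_sum le.
  have E (f : G -> nat) : \sum_(y in [set y in c]) f y = \sum_(y <- c) f y.
    by rewrite big_uniq //; apply: eq_bigl => y; rewrite inE.
  rewrite (E (fun=> 2)) (E (fun y => g y + g (next c y))) big_split /= (sum_next g uc) sc.
  rewrite big_const_seq count_predT iter_addn_0.
  case: ifP => [/forallP/(_ x)|_]; last by rewrite mul2n addnn ltnn.
  by rewrite inE xc => /eqP.
have [bc _] := andP bb.
have step x : x \in c -> g x = 1 -> g (next c x) = 1.
  by move=> /pairE + gx; rewrite gx; clear; lia.
have [i p E] := rot_to bc.
have cyc : fcycle (next c) (b :: p).
  by rewrite -E; have := cycle_next uc; rewrite -(rot_cycle i).
have walk : forall q y, y \in c -> g y = 1 -> fpath (next c) y q ->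
    forall x, x \in q -> g x = 1.
  elim=> //= z q IH y yc gy /andP[/eqP<- zq] x.
  by rewrite inE => /predU1P[->|]; [exact: step | apply: IH zq x; rewrite ?mem_next ?step].
move=> x; rewrite -(mem_rot i) E inE => /predU1P[->//|xp].
by apply: (walk _ _ bc gb cyc); rewrite mem_rcons inE xp orbT.
Qed.

Lemma sorted_alt_parity (f : {set G}) s : sorted (alt M) (f :: s) ->
  (last f s \in M) = (f \in M) (+) odd (size s).
Proof.
elim: s f => [|h s IH] f /=; first by rewrite addbF.
move=> /andP[fh /IH->]; move: fh; rewrite /alt.
by case: (f \in M); case: (h \in M) => //= _; rewrite ?addbN ?addNb ?negbK.
Qed.

Lemma last_walk_edge (x y : G) p : exists z,
  last [set x; y] (walk_edges y p) = [set z; last y p].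
Proof. by elim: p x y => [|z p IH] x y /=; [exists x | apply: IH]. Qed.

Lemma size_walk_edges (x : G) (p : seq G) : size (walk_edges x p) = size p.
Proof. exact: size_pairmap. Qed.

Lemma Jflower_ones c b p x : Jflower M c b p -> x \in c \/ x \in b :: p -> g x = 1.
Proof.
case=> [[bl bb] al ev fr]; have gb := blossom_base_ge1 bl bb.
suff main : forall z, z \in b :: p -> g z = 1.
  by case=> [|/main//]; apply: blossom_ones bl bb (main _ (mem_head _ _)) x.
case: p al ev fr => [|y p] al ev fr.
  move=> z; rewrite inE => /eqP->; move: gb (g_free fr) => /=; clear; lia.
have [z zE] := last_walk_edge b y p.
have lN : last [set b; y] (walk_edges y p) \notin M.
  apply: contra fr; rewrite zE setUC => h.
  by apply/(saturatedP _ mM); exists z.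
apply: (alt_walk_ones al); rewrite /tight_at; last first.
  by rewrite (negPf lN); apply: g_free fr.
(* The last edge ends in an unsaturated vertex, so it is outside [M]; as the length is even, the
   first edge is in [M]. *)
suff -> : [set b; y] \in M by [].
have [_ /sorted_alt_parity] := andP al; rewrite (negPf lN) size_walk_edges.
by move: ev => /=; rewrite negbK => ->; case: (_ \in M).
Qed.

Lemma Jposy_ones c1 c2 b1 q b2 x : Jposy M c1 c2 b1 q b2 ->
  [\/ x \in c1, x \in c2 | x \in b1 :: rcons q b2] -> g x = 1.
Proof.
case=> [[bl1 bb1] [bl2 bb2] /andP[al mm]].
have gb1 := blossom_base_ge1 bl1 bb1; have gb2 := blossom_base_ge1 bl2 bb2.
have main z : z \in b1 :: rcons q b2 -> g z = 1.
  move: al mm; have := last_rcons b1 q b2; case: (rcons q b2) => [|y p] //= E al.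
  move=> /andP[m1 m2]; apply: (alt_walk_ones al); rewrite /tight_at.
    by rewrite m1.
  by rewrite m2 E.
case=> [||/main//].
  by apply: blossom_ones bl1 bb1 (main _ (mem_head _ _)) x.
by apply: blossom_ones bl2 bb2 (main _ _) x; rewrite inE mem_rcons mem_head orbT.
Qed.

End Weights.

(** * Reduction to perfect matchings *)

Section Pendants.

Variables (G : sgraph) (M : {set {set G}}).
Hypothesis maxM : max_matching M.

Let mM : matching M. Proof. by case/andP: maxM. Qed.

Definition free := {x : G | ~~ saturated M x}.
Definition pendV : finType := (G + free)%type.

(* Every vertex missed by [M] receives a pendant neighbour carrying a loop: a *)
(* flower then becomes a barbell one of whose odd cycles is that loop.        *)
Definition pend : rel pendV := fun u w =>
  match u, w with
  | inl x, inl y => adj x y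
  | inl x, inr f => x == val f
  | inr f, inl x => x == val f
  | inr f, inr f' => f == f'
  end.

Lemma pend_sym : symmetric pend.
Proof. by case=> [x|f] [y|h] //=; apply: adj_sym. Qed.

Definition pend_mate (u : pendV) : pendV :=
  match u with
  | inl x => if insub x is Some f then inr f else inl (mate M x)
  | inr f => inl (val f)
  end.

Lemma pend_mate_sat x : saturated M x -> pend_mate (inl x) = inl (mate M x).
Proof. by move=> sx; rewrite /= insubF // sx. Qed.

Lemma mate_sat x : saturated M x -> saturated M (mate M x) /\ mate M (mate M x) = x.
Proof.
move=> sx; have := mateP mM sx; rewrite setUC => h; split; last exact: mateE.
by apply/(saturatedP _ mM); exists x.
Qed.

Lemma pend_mateP : pmf pend [set: pendV] pend_mate.
Proof.
case=> [x|f] _; rewrite !inE; last first.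
  by rewrite /= valK /=; split=> //; apply/eqP.
have [sx|sx] := boolP (saturated M x).
  have [smx mmx] := mate_sat sx.
  rewrite pend_mate_sat // pend_mate_sat // mmx /=.
  have ad := matching_adj mM (mateP mM sx).
  split=> //; apply: contraTneq ad => -[->]; by rewrite adj_irrefl.
by rewrite /= (insubT (fun x => ~~ saturated M x) sx) /=; split=> //; rewrite eqxx.
Qed.

(** At a free vertex the loop forces weight at least 1 on the pendant neighbour, which leaves at
    most 1 for the vertex itself. *)
Lemma half_cover_inl f : half_cover pend f ->
  [/\ forall x y, adj x y -> 2 <= f (inl x) + f (inl y),
      forall x y, [set x; y] \in M -> f (inl x) + f (inl y) = 2 &
      forall x, ~~ saturated M x -> f (inl x) <= 1].
Proof.
move=> fc; have pr := half_cover_pair pend_mateP _ fc; split.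
- by move=> x y xy; apply: fc.1.
- move=> x y xy; have sx : saturated M x by apply/(saturatedP _ mM); exists y.
  by have := pr (inl x); rewrite pend_mate_sat // (mateE mM xy).
- move=> x sx; have := pr (inl x); rewrite /= (insubT (fun x => ~~ saturated M x) sx).
  set u := inr _; have /fc.1 : pend u u by rewrite /= eqxx.
  by clear; lia.
Qed.

Lemma Jflower_central v : in_Jflower M v -> central pend (inl v).
Proof.
case=> c [b [p [J vJ]]] f /half_cover_inl[h1 h2 h3].
exact: (@Jflower_ones G M (fun x => f (inl x)) mM h1 h2 h3 c b p v J vJ).
Qed.

Lemma Jposy_central v : in_Jposy M v -> central pend (inl v).
Proof.
case=> c1 [c2 [b1 [q [b2 [J vJ]]]]] f /half_cover_inl[h1 h2 h3].
exact: (@Jposy_ones G M (fun x => f (inl x)) mM h1 h2 c1 c2 b1 q b2 v J vJ).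
Qed.

Definition T_central v := exists N : {set {set G}},
  max_matching N /\ (in_Tflower N v \/ in_Tposy N v).

Definition satM := [set x | saturated M x].

Lemma satM_cover : satM = cover M.
Proof. by apply/setP=> x; rewrite inE. Qed.

Section Restriction.

Variable s : pendV -> pendV.
Hypothesis sP : pmf pend [set: pendV] s.

Definition restr x := if s (inl x) is inl y then y else x.

Lemma s_free f : s (inr f) = inl (val f).
Proof.
have [_ _ ne] := sP (in_setT (inr f)).
by case: (s (inr f)) ne => [x _ /eqP->|f' /= + /eqP fE] //; rewrite fE eqxx.
Qed.

Lemma s_sat x : saturated M x -> s (inl x) = inl (restr x).
Proof.
move=> sx; rewrite /restr; have [_ sK _] := sP (in_setT (inl x)).
case E: (s (inl x)) => [y|f] //= /eqP xf.
by move: sx; rewrite xf (negPf (valP f)).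
Qed.

Lemma s_unsat x y : s (inl x) = inl y -> saturated M x.
Proof.
move=> sx; apply/negPn/negP=> ux; have := s_free (Sub x ux).
have [_ sK _ _] := sP (in_setT (inl x)); rewrite SubK => E.
have [_ sK' _ _] := sP (in_setT (inr (Sub x ux))).
by move: sK'; rewrite E sx.
Qed.

Lemma restrP : pmf (@adj G) satM restr.
Proof.
move=> x; rewrite !inE => sx; have [_ sK sn ad] := sP (in_setT (inl x)).
rewrite (s_sat sx) in sK sn ad; have sy := s_unsat sK.
split=> //.
by have := s_sat sy; rewrite sK => -[].
Qed.

(** Every perfect matching pairs each pendant vertex with its free vertex, since the loop cannot be
    used. What remains covers the same vertices of [G] as [M], so it has the same size and is
    maximum. *)
Lemma restr_matching : exists N, [/\ max_matching N,
  forall x, saturated N x = saturated M x &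
  forall l, paired s (map inl l) -> mpaired N l].
Proof.
have [mN cN NE] := pm_matching restrP.
set N := [set _ | x in _] in mN cN NE; exists N.
have cE : cover N = cover M by rewrite cN satM_cover.
have NM : #|N| = #|M|.
  apply/eqP; rewrite -(eqn_pmul2r (isT : 0 < 2)).
  by rewrite -(matching_card mN) -(matching_card mM) cE.
split.
- apply/andP; split=> //; apply/forallP=> N'; rewrite NM.
  by have /andP[_ /forallP/(_ N')] := maxM.
- by move=> x; rewrite /saturated cE.
- elim/seq_pair_ind=> //= x y l IH [sx _ /IH->].
  by rewrite NE inE (s_unsat sx) /restr sx eqxx.
Qed.

End Restriction.

Lemma klink_inl k a p b :
  klink pend k (inl a) (map inl p) (inl b) = klink (@adj G) k a p b.
Proof. by rewrite /klink /link -map_rcons path_map size_map. Qed.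

Lemma inl_seq (l : seq pendV) : (forall f, inr f \notin l) ->
  exists l' : seq G, l = map inl l'.
Proof.
elim: l => [|[x|f] l IH] h; first by exists [::].
  have [|l' ->] := IH; last by exists (x :: l').
  by move=> f; have := h f; rewrite inE negb_or => /andP[].
by have := h f; rewrite mem_head.
Qed.

Lemma pend_inr_inj u f w : pend u (inr f) -> pend (inr f) w -> u != inr f ->
  w != inr f -> u = w.
Proof.
case: u => [x|f1] /=; last by move=> /eqP-> _; rewrite eqxx.
case: w => [y|f2] /=; last by move=> _ /eqP-> _; rewrite eqxx.
by move=> /eqP-> /eqP->.
Qed.

(** A pendant vertex has a single neighbour besides itself, so it cannot lie between two different
    vertices. The condition for [size p == 1] excludes going to the pendant vertex and straight
    back. *)
Lemma inr_interior a p b f : link pend a p b -> uniq (a :: p) -> b \notin p ->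
  (size p == 1 -> a != b) -> inr f \notin p.
Proof.
move=> l u bp ab; apply/negP=> fp; have [p1 [p2 E]] := mem_split fp.
rewrite {p fp}E in l u bp ab.
move: l; rewrite link_cat => /andP[]; rewrite /link rcons_path => /andP[_ h1] h2.
have u1 : last a p1 != inr f.
  have := mem_last a p1; move: u; rewrite -cat_cons cat_uniq => /and3P[_ /hasPn/(_ (inr f)) h _].
  by apply: contraTneq => ->; apply: h; rewrite mem_head.
have h3 : pend (inr f) (head b p2) by case: p2 h2 {u bp ab} => /= [|c p2] /andP[].
have u2 : head b p2 != inr f.
  case: p2 {h2 ab h3} u bp => [|c p2] u bp; rewrite [head _ _]/=.
    by apply: contraNneq bp => <-; rewrite mem_cat mem_head orbT.
  by apply: contraTneq u => ->; rewrite -cat_cons cat_uniq /= mem_head !andbF.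
have E := pend_inr_inj h1 h3 u1 u2.
case: p2 E u bp ab {h2 h3 u2} => [|c p2] E u bp ab; rewrite [head _ _]/= in E.
  case/lastP: p1 E u bp ab {h1 u1} => [|p1 d] E u bp ab.
    by have := ab isT; rewrite -E /= eqxx.
  by move: bp; rewrite -E last_rcons mem_cat mem_rcons mem_head.
move: u; rewrite -cat_cons cat_uniq => /and3P[_ /hasPn/(_ c) h _].
have cm : c \in a :: p1 by rewrite -E mem_last.
have /h : c \in [:: inr f, c & p2] by rewrite !inE eqxx orbT.
by rewrite /= cm.
Qed.

Lemma inr_even a p b f : klink pend false a p b -> uniq (a :: p) -> b \notin p ->
  inr f \notin p.
Proof.
by case/andP=> l ev u bp; apply: inr_interior l u bp _ => /eqP E; rewrite E in ev.
Qed.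

(** Otherwise the cycle could be rotated to another base, with the pendant vertex in its
    interior. *)
Lemma inr_loop b o f : klink pend false b o b -> uniq (b :: o) -> b = inr f ->
  o = [::].
Proof.
move=> l u bf; case: o l u => [|x o] // l u.
have xi : x \in b :: x :: o by rewrite !inE eqxx orbT.
have [o' l' pe] := cycle_rot l xi.
have u' : uniq (x :: o') by rewrite -(perm_uniq pe).
have : b \in x :: o' by rewrite -(perm_mem pe) mem_head.
rewrite inE => /predU1P[E|]; first by move: u; rewrite E /= mem_head.
have xo : x \notin o' by case/andP: u'.
by rewrite bf (negPf (inr_even f l' u' xo)).
Qed.

Lemma barbell_uniq (T : finType) (b1 : T) o1 q b2 o2 :
  uniq (barbell_seq b1 o1 q b2 o2) ->
  [/\ uniq (b1 :: o1), uniq (b2 :: o2), uniq (b1 :: rcons q b2) & uniq (q ++ o2)].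
Proof.
move=> u.
have sub l : subseq l (barbell_seq b1 o1 q b2 o2) -> uniq l by move/subseq_uniq; apply.
split; apply: sub; rewrite /barbell_seq.
- by rewrite -cat_cons prefix_subseq.
- by rewrite -cat_cons catA suffix_subseq.
- rewrite /= eqxx -[rcons q b2]cat0s; apply: cat_subseq; first exact: sub0seq.
  by rewrite -cats1; apply: cat_subseq; rewrite // sub1seq mem_head.
- apply: (subseq_trans _ (subseq_cons _ b1)).
  apply: (subseq_trans _ (suffix_subseq o1 _)).
  by apply: cat_subseq; rewrite // subseq_cons.
Qed.

Lemma barbell_interior b1 o1 q b2 o2 : barbell pend b1 o1 q b2 o2 ->
  uniq (barbell_seq b1 o1 q b2 o2) ->
  exists o1' q' o2', [/\ o1 = map inl o1', q = map inl q' & o2 = map inl o2'].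
Proof.
move=> [l1 l2 l3] /barbell_uniq[u1 u2 uq _].
have [|o1' ->] := @inl_seq o1.
  by move=> f; apply: (inr_even f l1 u1); case/andP: u1.
have [|o2' ->] := @inl_seq o2.
  by move=> f; apply: (inr_even f l3 u2); case/andP: u2.
have [|q' ->] := @inl_seq q; last by exists o1', q', o2'.
move: uq; rewrite -rcons_cons rcons_uniq inE negb_or => /andP[/andP[_ b2q] uq] f.
exact: inr_even l2 uq b2q.
Qed.

Lemma map_inl_uniq l : uniq (map inl l : seq pendV) = uniq l.
Proof. by rewrite map_inj_uniq // => x y []. Qed.

Lemma mem_map_inl v l : (inl v \in (map inl l : seq pendV)) = (v \in l).
Proof. by rewrite mem_map // => x y []. Qed.

(** * Frames of the pendant graph read back in [G] *)

Lemma posy_central b1 o1 q b2 o2 v :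
  barbell pend (inl b1) o1 q (inl b2) o2 ->
  niceu pend (barbell_seq (inl b1) o1 q (inl b2) o2) ->
  inl v \in barbell_seq (inl b1) o1 q (inl b2) o2 -> T_central v.
Proof.
move=> bb n vb; have [o1' [q' [o2' [E1 E2 E3]]]] := barbell_interior bb n.1.
rewrite {}E1 {}E2 {}E3 in bb n vb; have [l1 l2 l3] := bb.
have ev : all (evc pend) [:: map inl o1'; inl b1 :: rcons (map inl q') (inl b2); map inl o2'].
  by rewrite /= (evc_in l1) (evc_in l3) (evc_lr l2).
have [|s [sP sl _]] := niceu_total pend_sym ev n; first by perm_count.
have [N [mN _ pN]] := restr_matching sP.
have p1 : mpaired N o1' by apply: pN; apply: sl; rewrite !inE eqxx.
have p2 : mpaired N o2' by apply: pN; apply: sl; rewrite !inE eqxx !orbT.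
have pq : mpaired N (b1 :: rcons q' b2).
  by apply: pN; rewrite map_cons map_rcons; apply: sl; rewrite !inE eqxx !orbT.
have nE : barbell_seq (inl b1) (map inl o1') (map inl q') (inl b2) (map inl o2') =
    map inl (barbell_seq b1 o1' q' b2 o2') :> seq pendV.
  by rewrite /barbell_seq /= !map_cat.
rewrite {}nE in n vb; rewrite !klink_inl in l1 l2 l3.
have u : uniq (barbell_seq b1 o1' q' b2 o2') by rewrite -map_inl_uniq; exact: n.1.
exists N; split=> //; right; exists (b1 :: o1'), (b2 :: o2'), b1, q', b2.
split; first by apply: barbell_Tposy => //; case/andP: mN.
move: vb; rewrite mem_map_inl /barbell_seq -cat_cons !mem_cat => /or3P[h|h|h].
- by constructor 1.
- by constructor 3; rewrite inE mem_rcons inE h !orbT.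
- by constructor 2.
Qed.

(** The cycle at [inr f] is the loop. Removing it with [inr f] leaves a blossom at [b2] and a path
    from [b2] to the unsaturated vertex [val f]; when [q] is empty, [b2] is that vertex and the stem
    has length zero. *)
Lemma flower_central f o1 q b2 o2 v :
  barbell pend (inr f) o1 q (inl b2) o2 ->
  niceu pend (barbell_seq (inr f) o1 q (inl b2) o2) ->
  inl v \in barbell_seq (inr f) o1 q (inl b2) o2 -> T_central v.
Proof.
move=> bb n vb; have [u1 u2 uq uqo] := barbell_uniq n.1.
have o1E : o1 = [::] by have [l1 _ _] := bb; apply: inr_loop l1 u1 erefl.
have [_ [q' [o2' [_ E2 E3]]]] := barbell_interior bb n.1.
rewrite {}E2 {}E3 {}o1E {u1} in bb n vb u2 uq uqo; have [l1 l2 l3] := bb.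
have ev : all (evc pend) [:: inr f :: rcons (map inl q') (inl b2); map inl o2'].
  by rewrite /= (evc_in l3) (evc_lr l2).
have [|s [sP sl _]] := niceu_total pend_sym ev n; first by perm_count.
have [N [maxN sN pN]] := restr_matching sP; have /andP[mN _] := maxN.
have p2 : mpaired N o2' by apply: pN; apply: sl; rewrite !inE eqxx !orbT.
have pq : paired s (inr f :: rcons (map inl q') (inl b2)) by apply: sl; rewrite mem_head.
have fN : ~~ saturated N (val f) by rewrite sN (valP f).
have v2 : v \in b2 :: o2' ++ q'.
  by rewrite -mem_map_inl /= map_cat; move: vb; rewrite !(in_cons, mem_cat) /= => /or3P[]->;
    rewrite ?orbT.
rewrite klink_inl in l3.
exists N; split=> //; left.
case: q' l2 bb n vb uq uqo ev sl pq v2 => [|y q'] l2 bb n vb uq uqo ev sl pq v2.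
  have E : b2 = val f by move: l2; rewrite /klink /link /= => /andP[/andP[/eqP]].
  exists (b2 :: o2'), b2, [::]; split; last by left; move: v2; rewrite cats0.
  apply: blossom_Tflower => //; last by rewrite E.
  by rewrite -map_inl_uniq.
have yE : y = val f by move: l2; rewrite /klink /link /= => /andP[/andP[/eqP]].
exists (b2 :: o2'), b2, (rcons (rev q') y); split; last first.
  by move: v2; rewrite !inE mem_cat mem_rcons !inE mem_rev => /or3P[->|->|/orP[]->];
    rewrite ?orbT; auto.
have lq : link (@adj G) y q' b2.
  have : klink (@adj G) (odd (size q')) y q' b2.
    rewrite -klink_inl /klink size_map eqxx andbT.
    by move: l2; rewrite /klink /link /= => /andP[/andP[]].
  by case/andP.
apply: stem_Tflower => //.
- by rewrite (link_rev (@adj_sym G)).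
- have -> : uniq (b2 :: o2' ++ rcons (rev q') y) = uniq ((y :: q') ++ b2 :: o2').
    by apply: perm_uniq; perm_count.
  rewrite -map_inl_uniq map_cat /=.
  by have := n.1; rewrite /barbell_seq /= => /andP[].
- have -> : b2 :: rev q' = rev (rcons q' b2) by rewrite rev_rcons.
  apply: mpaired_rev; apply: pN; rewrite map_rcons.
  by case: pq.
- by rewrite yE.
Qed.

(** The path [q] would be augmenting: matching it within itself, and [satM] outside it by [s],
    covers all of [satM] and also [val f], against the maximality of [M]. *)
Lemma no_free_free f f' o1 q o2 :
  barbell pend (inr f) o1 q (inr f') o2 ->
  niceu pend (barbell_seq (inr f) o1 q (inr f') o2) -> False.
Proof.
move=> bb n; have [u1 u2 uq uqo] := barbell_uniq n.1.
have [l1 l2 l3] := bb.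
have o1E : o1 = [::] by apply: inr_loop l1 u1 erefl.
have o2E : o2 = [::] by apply: inr_loop l3 u2 erefl.
have [_ [q' [_ [_ E2 _]]]] := barbell_interior bb n.1.
rewrite {}E2 {}o1E {}o2E {u1 u2 uqo} in bb n uq l1 l2 l3.
have ev : all (evc pend) [:: inr f :: rcons (map inl q') (inr f')].
  by rewrite /= (evc_lr l2).
have [|s [sP sl sc]] := niceu_total pend_sym ev n; first by perm_count.
have evq : evc (@adj G) q'.
  have := evc_in l2; rewrite /evc size_map; case/andP=> + ->; rewrite andbT.
  by case: (q') => //= y r; rewrite path_map.
have q'0 : val f \in q'.
  case: q' l2 uq {bb n l1 l3 ev sl sc evq} => [|y r]; rewrite /klink /link /=.
    by case/andP=> /andP[/eqP-> _] _; rewrite inE eqxx.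
  by case/andP=> /andP[/eqP-> _] _ _; rewrite mem_head.
have qc x : (x \in q') = (inl x \in barbell_seq (inr f) [::] (map inl q') (inr f') [::]).
  by rewrite !(inE, mem_cat) /= orbF mem_map_inl.
pose A := satM :\: [set x in q'].
have tA : pmf (@adj G) A (restr s).
  move=> x; rewrite in_setD in_set => /andP[xq xs].
  have [h1 h2 h3 h4] := restrP sP xs; split=> //.
  rewrite in_setD h1 andbT in_set; apply: contra xq.
  rewrite in_set in xs; rewrite !qc => /sc; rewrite in_set in h1.
  by rewrite (s_sat sP h1) h2.
have uq' : uniq q'.
  by move: uq; rewrite -map_inl_uniq -rcons_cons rcons_uniq => /andP[_ /andP[]].
have [|s' [s'P _ _]] := pm_glue (@adj_sym G) evq uq' _ tA.
  by rewrite disjoint_subset; apply/subsetP=> x xq; rewrite !inE xq.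
have [mN cN _] := pm_matching s'P.
set N := [set _ | x in _] in mN cN.
have /andP[_ /forallP/(_ N)] := maxM; rewrite mN /= => le.
have : satM \proper A :|: [set x in q'].
  apply/properP; split.
    by apply/subsetP=> x xs; rewrite !inE; rewrite inE in xs; rewrite xs andbT orNb.
  by exists (val f); rewrite !inE ?q'0 ?orbT // (valP f).
move/proper_card; rewrite -cN satM_cover !matching_card // ltn_pmul2r //.
by rewrite ltnNge le.
Qed.

Lemma k4_central a b c d ab ac ad bc bd cd v :
  k4 pend a b c d ab ac ad bc bd cd ->
  niceu pend (k4_seq a b c d ab ac ad bc bd cd) ->
  inl v \in k4_seq a b c d ab ac ad bc bd cd -> T_central v.
Proof.
move=> k n vb.
have noinr f : inr f \notin k4_seq a b c d ab ac ad bc bd cd.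
  set W := k4_seq _ _ _ _ _ _ _ _ _ _.
  have kW : k4_on pend W a b c d ab ac ad bc bd cd by [].
  apply/negP=> fW.
  (* Each vertex of a subdivided K4 is, for some labelling, interior to a path from [b'] through
     [a'] to [c'], and such a path has no pendant vertex inside. *)
  have cut (a' b' c' d' : pendV) ab' ac' ad' bc' bd' cd' :
      k4_on pend W a' b' c' d' ab' ac' ad' bc' bd' cd' ->
      inr f \notin rev ab' ++ a' :: ac'.
    case=> -[[l1 l2 _] _] pe.
    have u : uniq (b' :: c' :: rev ab' ++ a' :: ac').
      have : uniq ((b' :: c' :: rev ab' ++ a' :: ac') ++ d' :: ad' ++ bc' ++ bd' ++ cd').
        by rewrite -(perm_uniq (_ : perm_eq W _)) ?n.1 //; perm_count_with pe.
      by rewrite cat_uniq => /andP[].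
    have {u}[b'c' u1 u2] : [/\ b' != c', c' \notin rev ab' ++ a' :: ac' &
                     uniq (b' :: rev ab' ++ a' :: ac')].
      move: u; rewrite /= !in_cons negb_or => /andP[/andP[-> ->]] /andP[-> ->].
      by [].
    by have /andP[l _] := oo (olr pend_sym l1) l2; apply: inr_interior l u2 u1 _.
  have [i|i] := boolP (inr f \in [:: a; b; c; d]).
    have [b' [c' [d' [ab' [ac' [ad' [bc' [bd' [cd' k']]]]]]]]] := k4_branch pend_sym kW i.
    by have := cut _ _ _ _ _ _ _ _ _ _ k'; rewrite mem_cat mem_head orbT.
  have [a' [b' [c' [d' [ab' [ac' [ad' [bc' [bd' [cd' [k' j]]]]]]]]]]] :=
    k4_interior pend_sym kW fW i.
  by have := cut _ _ _ _ _ _ _ _ _ _ k'; rewrite mem_cat mem_rev j.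
have inlE (x : pendV) : x \in k4_seq a b c d ab ac ad bc bd cd -> exists y, x = inl y.
  by case: x => [y|f xW]; [exists y | have := noinr f; rewrite xW].
have sub (l : seq pendV) : {subset l <= k4_seq a b c d ab ac ad bc bd cd} ->
    exists l', l = map inl l'.
  by move=> h; apply: inl_seq => f; apply: contra (noinr f) => /h.
have [a' aE] : exists y, a = inl y by apply: inlE; rewrite !inE eqxx.
have [b' bE] : exists y, b = inl y by apply: inlE; rewrite !inE eqxx ?orbT.
have [c' cE] : exists y, c = inl y by apply: inlE; rewrite !inE eqxx ?orbT.
have [d' dE] : exists y, d = inl y by apply: inlE; rewrite !inE eqxx ?orbT.
have [ab' abE] : exists l, ab = map inl l by apply: sub; sub_mem.
have [ac' acE] : exists l, ac = map inl l by apply: sub; sub_mem.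
have [ad' adE] : exists l, ad = map inl l by apply: sub; sub_mem.
have [bc' bcE] : exists l, bc = map inl l by apply: sub; sub_mem.
have [bd' bdE] : exists l, bd = map inl l by apply: sub; sub_mem.
have [cd' cdE] : exists l, cd = map inl l by apply: sub; sub_mem.
rewrite {noinr inlE sub}aE bE cE dE abE acE adE bcE bdE cdE in k n vb.
have nE : k4_seq (inl a') (inl b') (inl c') (inl d') (map inl ab') (map inl ac')
    (map inl ad') (map inl bc') (map inl bd') (map inl cd') =
    map inl (k4_seq a' b' c' d' ab' ac' ad' bc' bd' cd') :> seq pendV.
  by rewrite /k4_seq /= !map_cat.
have [[l1 l2 l3] [l4 l5 l6]] := k.
have ev : all (evc pend) [:: inl a' :: rcons (map inl ab') (inl b');
    inl c' :: rcons (map inl cd') (inl d'); map inl ac'; map inl ad'; map inl bc'; map inl bd'].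
  by rewrite /= (evc_lr l1) (evc_lr l6) (evc_in l2) (evc_in l3) (evc_in l4) (evc_in l5).
have [|s [sP sl _]] := niceu_total pend_sym ev n; first by perm_count.
have [N [maxN _ pN]] := restr_matching sP; have /andP[mN _] := maxN.
have pab : mpaired N (a' :: rcons ab' b').
  by apply: pN; rewrite map_cons map_rcons; apply: sl; rewrite !inE eqxx ?orbT.
have pcd : mpaired N (c' :: rcons cd' d').
  by apply: pN; rewrite map_cons map_rcons; apply: sl; rewrite !inE eqxx ?orbT.
have [pac pad pbc pbd] : [/\ mpaired N ac', mpaired N ad', mpaired N bc' & mpaired N bd'].
  by split; apply: pN; apply: sl; rewrite !inE eqxx ?orbT.
rewrite {}nE in n vb; rewrite !klink_inl in l1 l2 l3 l4 l5 l6.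
have u : uniq (k4_seq a' b' c' d' ab' ac' ad' bc' bd' cd') by rewrite -map_inl_uniq; exact: n.1.
have k' : k4 (@adj G) a' b' c' d' ab' ac' ad' bc' bd' cd' by [].
exists N; split=> //; right; do 5 eexists; split.
  exact: k4_Tposy mN k' u pab pcd pac pad pbc pbd.
move: vb; rewrite mem_map_inl /k4_seq !mem_cat => /or4P[|h|h|/or4P[]h].
- rewrite !inE => /or4P[]/eqP->; [constructor 3|constructor 3|constructor 1|constructor 1];
    by rewrite !(inE, mem_cat, mem_rcons) eqxx ?orbT.
- by constructor 3; rewrite !(inE, mem_rcons) h !orbT.
- by constructor 1; rewrite !(inE, mem_cat) h !orbT.
- by constructor 1; rewrite !(inE, mem_cat, mem_rev) h !orbT.
- by constructor 2; rewrite !(inE, mem_cat) h !orbT.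
- by constructor 2; rewrite !(inE, mem_cat, mem_rev) h !orbT.
- by constructor 1; rewrite !(inE, mem_cat) h !orbT.
Qed.

Lemma framed_T_central v : framed pend [:: inl v] -> T_central v.
Proof.
case=> vs [fr n /(_ (inl v) (mem_head _ _))].
case: fr n => [b1 o1 q b2 o2 bb|a b c d ab ac ad bc bd cd k] n vb; last exact: k4_central vb.
have pe : perm_eq (barbell_seq b1 o1 q b2 o2) (barbell_seq b2 o2 (rev q) b1 o1).
  by perm_count.
have n' := niceu_perm pe n; have bb' := barbell_sym pend_sym bb.
have vb' := vb; rewrite (perm_mem pe) in vb'.
case: b1 b2 bb bb' n n' vb vb' {pe} => [b1|f1] [b2|f2] bb bb' n n' vb vb'.
- exact: posy_central bb n vb.
- exact: flower_central bb' n' vb'.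
- exact: flower_central bb n vb.
- by case: (no_free_free bb n).
Qed.

End Pendants.

Theorem theorem1p3 (G : sgraph) :
  sterboul_deming G <->
  forall v : G, exists M : {set {set G}},
    max_matching M /\ (in_Jposy M v \/ in_Jflower M v).
Proof.
split=> [SDG v|J].
  have : v \in SD G.
    have : v \notin KE G by rewrite SDG inE.
    by rewrite !inE andbT negbK.
  rewrite inE => /asboolP[M [maxM T]]; exists M; split=> //.
  case: T => [[c [b [p [[h1 h2 h3 h4 _] vT]]]]|[c1 [c2 [b1 [q [b2 [[h1 h2 h3 _ _] vT]]]]]]].
    by right; exists c, b, p; split=> //; split=> //; case/andP: h2.
  by left; exists c1, c2, b1, q, b2; split=> //; split=> //; case/andP: h3.
apply/setP=> v; rewrite !inE andbT; apply/negbTE; rewrite negbK; apply/asboolP.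
have [M [maxM Jv]] := J v; have mM : matching M by case/andP: maxM.
apply: (framed_T_central maxM); apply: central_framed (pend_mateP maxM) _.
  exact: pend_sym.
by case: Jv => [/(Jposy_central maxM)|/(Jflower_central maxM)].
Qed.
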